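(* Let $\xi=(G,\mathcal{L},\mathcal{A})$ be an irreducible triplet on a strongly connected multigraph $G$. If $\xi$ possesses a dominant product with a unique and simple leading eigenvalue, then $\xi$ possesses a polytope Barabanov multinorm, i.e. there are norms $\|\cdot\|_i$ on $L_i$, $i=1,\dots,n$, whose unit balls are polytopes, such that for every $i$ and every $x\in L_i$ $$\max_{A_{ji}\in\mathcal{A}_{ji},\ j=1,\dots,n}\|A_{ji}x\|_j=\rho(\xi)\,\|x\|_i .$$
   Context: A triplet (system) $\xi=(G,\mathcal{L},\mathcal{A})$ consists of: a finite directed multigraph $G$ with vertices $1,\dots,n$ (loops and multiple edges allowed, finitely many edges); real linear spaces $\mathcal{L}=(L_1,\dots,L_n)$ with $1\le\dim L_i<\infty$, $L_i$ attached to vertex $i$; and, for every edge from $i$ to $j$, a linear operator $A_{ji}:L_i\to L_j$. $\mathcal{A}_{ji}$ is the finite (possibly empty) family of operators of edges from $i$ to $j$, and $\mathcal{A}=\bigcup_{i,j}\mathcal{A}_{ji}$. $G$ is strongly connected if for every pair of vertices there is a path from one to the other. A path $\alpha$ is a sequence of consecutive edges; $|\alpha|$ is its number of edges. For a path $i_1\to i_2\to\dots\to i_{k+1}$ with operators $A_{i_{s+1}i_s}$, $\Pi_\alpha=A_{i_{k+1}i_k}\cdots A_{i_2i_1}:L_{i_1}\to L_{i_{k+1}}$. The path is closed if $i_1=i_{k+1}$. A nonempty closed path is simple if it is not a power (repeated concatenation with itself) of a shorter closed path. For a closed path, $\rho(\Pi_\alpha)$ is the usual spectral radius (largest modulus of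 complex eigenvalues). A simple closed path $\alpha$ (with $\rho(\Pi_\alpha)>0$) and the corresponding product $\Pi_\alpha$ are called dominant if there is a constant $q<1$ such that, for the normalized family $\widetilde{\mathcal{A}}=\rho(\Pi_\alpha)^{-1/|\alpha|}\mathcal{A}$ (all operators multiplied by this scalar), the spectral radii of the products corresponding to all simple closed paths other than the cyclic permutations of $\alpha$ are smaller than $q$. The leading eigenvalue of $\Pi_\alpha$ is its eigenvalue of largest modulus; it is unique and simple if exactly one eigenvalue has the largest modulus and it has algebraic multiplicity one. A multinorm is a collection of norms $\|\cdot\|_i$ on $L_i$, $i=1,\dots,n$; for an operator $A:L_i\to L_j$, $\|A\|=\sup_{\|x\|_i=1}\|Ax\|_j$. The joint spectral radius is $\rho(\xi)=\lim_{k\to\infty}\max_{|\alpha|=k}\|\Pi_\alpha\|^{1/k}$ (the limit exists and does not depend on the multinorm). A triplet $\xi'=(G,\mathcal{L}',\mathcal{A}')$ (same multigraph, spaces not all zero, some possibly zero) is embedded in $\xi$ if $L_i'\subset L_i$ is a subspace for each $i$ and for every edge from $i$ to $j$ its operator in $\xi'$ is the restriction $A_{ji}|_{L_i'}$, which maps $L_i'$ into $L_j'$. The embedding is strict if $L_i'\ne L_i$ for at least one $i$. $\xi$ is reducible if it has a strictly embedded triplet, and irreducible otherwise. *)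

(* Defs.v *)
From HB Require Import structures.
From mathcomp Require Import all_boot all_order all_algebra.
From mathcomp Require Import all_classical all_reals all_analysis.
From mathcomp.real_closed Require Import complex.
Set Implicit Arguments.
Unset Strict Implicit.
Unset Printing Implicit Defensive.
Import Order.TTheory GRing.Theory Num.Theory.
Import numFieldNormedType.Exports.
Import passmx.
Local Open Scope classical_set_scope.
Local Open Scope ring_scope.

(* [edge i j] is the type of edges from [i] to [j]. *)
Record multigraph := Multigraph {
  nvert : nat;
  edge : 'I_nvert -> 'I_nvert -> finType
}.

Inductive walk (G : multigraph) (i : 'I_(nvert G)) : 'I_(nvert G) -> Type :=
| walk_nil : walk i i
| walk_rcons j k : walk i j -> edge j k -> walk i k.

Definition arrow (G : multigraph) : Type :=
  {ij : 'I_(nvert G) * 'I_(nvert G) & edge ij.1 ij.2}.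

Definition pack (G : multigraph) (i j : 'I_(nvert G)) (e : edge i j) : arrow G :=
  existT (fun ij : 'I_(nvert G) * 'I_(nvert G) => edge ij.1 ij.2 : Type) (i, j) e.

(* A walk of positive length is determined by its sequence of edges. *)
Fixpoint edges (G : multigraph) (i j : 'I_(nvert G)) (w : walk i j) :
    seq (arrow G) :=
  match w with
  | walk_nil => [::]
  | walk_rcons _ _ w' e => rcons (edges w') (pack e)
  end.

Definition walk_length (G : multigraph) (i j : 'I_(nvert G)) (w : walk i j) : nat :=
  size (edges w).

(* The empty walk joins a vertex to itself, so this only constrains pairs of
   distinct vertices. *)
Definition strongly_connected (G : multigraph) : Prop :=
  forall i j : 'I_(nvert G), inhabited (walk i j).

Definition simple_closed (G : multigraph) (i : 'I_(nvert G)) (a : walk i i) :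
    Prop :=
  (0 < walk_length a)%N /\
  ~ exists (b : walk i i) (m : nat),
      (walk_length b < walk_length a)%N /\ edges a = flatten (nseq m (edges b)).

Definition cyclic_perm (G : multigraph) (i j : 'I_(nvert G))
    (a : walk i i) (b : walk j j) : Prop :=
  exists m : nat, edges b = rot m (edges a).

Record triplet (R : realType) (G : multigraph) := Triplet {
  lspace : 'I_(nvert G) -> vectType R;
  lspace_dim_gt0 : forall i, (0 < \dim {: lspace i})%N;
  op : forall i j, edge i j -> 'Hom(lspace i, lspace j)
}.

Arguments op {R G} t {i j} e.

Fixpoint wprod (R : realType) (G : multigraph) (xi : triplet R G)
    (i j : 'I_(nvert G)) (w : walk i j) : 'Hom(lspace xi i, lspace xi j) :=
  match w with
  | walk_nil => \1%VF
  | walk_rcons _ _ w' e => (op xi e \o wprod xi w')%VF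
  end.

Definition scale_triplet (R : realType) (G : multigraph) (c : R)
    (xi : triplet R G) : triplet R G :=
  {| lspace := lspace xi;
     lspace_dim_gt0 := @lspace_dim_gt0 R G xi;
     op := fun i j (e : edge i j) => c *: op xi e |}.

(* A triplet embedded in [xi] is determined by its subspaces: its operators have
   to be the restrictions of those of [xi]. *)
Definition embedded (R : realType) (G : multigraph) (xi : triplet R G)
    (U : forall i, {vspace lspace xi i}) : Prop :=
  (exists i, U i != 0%VS) /\
  forall i j (e : edge i j), (op xi e @: U i <= U j)%VS.

Arguments embedded {R G} xi U.

Definition reducible (R : realType) (G : multigraph) (xi : triplet R G) : Prop :=
  exists U : forall i, {vspace lspace xi i},
    embedded xi U /\ exists i, U i != fullv.

Definition irreducible (R : realType) (G : multigraph) (xi : triplet R G) : Prop :=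
  ~ reducible xi.

(* The matrix acts on row vectors; this does not affect the spectrum. *)
Definition complex_mx (R : realType) (V : vectType R) (f : 'End(V)) :
    'M[R[i]]_(\dim {: V}) :=
  map_mx (real_complex R) (mxof (vbasis {: V}) (vbasis {: V}) f).

Definition complex_eigenvalue (R : realType) (V : vectType R) (f : 'End(V))
    (l : R[i]) : Prop := eigenvalue (complex_mx f) l.

Definition alg_multiplicity (R : realType) (V : vectType R) (f : 'End(V))
    (l : R[i]) : nat := mup l (char_poly (complex_mx f)).

Definition spectral_radius (R : realType) (V : vectType R) (f : 'End(V)) : R :=
  sup [set Normc.normc l | l in [set l | complex_eigenvalue f l]].

Definition unique_simple_leading_eigenvalue (R : realType) (V : vectType R)
    (f : 'End(V)) : Prop :=
  exists l : R[i],
    [/\ complex_eigenvalue f l,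
        forall m : R[i], complex_eigenvalue f m -> m <> l ->
          Normc.normc m < Normc.normc l
      & alg_multiplicity f l = 1%N].

Definition normalized (R : realType) (G : multigraph) (xi : triplet R G)
    (i : 'I_(nvert G)) (a : walk i i) : triplet R G :=
  scale_triplet (spectral_radius (wprod xi a) `^ (- (walk_length a)%:R^-1)) xi.

Definition dominant (R : realType) (G : multigraph) (xi : triplet R G)
    (i : 'I_(nvert G)) (a : walk i i) : Prop :=
  [/\ simple_closed a,
      0 < spectral_radius (wprod xi a)
    & exists2 q : R, q < 1 &
        forall (j : 'I_(nvert G)) (b : walk j j),
          simple_closed b -> ~ cyclic_perm a b ->
          spectral_radius (wprod (normalized xi a) b) < q].

Definition is_norm (R : realType) (V : vectType R) (N : V -> R) : Prop :=
  [/\ forall x, 0 <= N x,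
      forall x, N x = 0 -> x = 0,
      forall (c : R) x, N (c *: x) = `|c| * N x
    & forall x y, N (x + y) <= N x + N y].

Definition is_multinorm (R : realType) (G : multigraph) (xi : triplet R G)
    (nu : forall i, lspace xi i -> R) : Prop :=
  forall i, is_norm (@nu i).

Arguments is_multinorm {R G} xi nu.

Definition op_norm (R : realType) (V W : vectType R) (N : V -> R) (N' : W -> R)
    (f : 'Hom(V, W)) : R :=
  sup [set N' (f x) | x in [set x | N x = 1]].

(* There are finitely many walks of length [k], so the supremum is a maximum
   (and [0] when there are none). *)
Definition max_growth (R : realType) (G : multigraph) (xi : triplet R G)
    (nu : forall i, lspace xi i -> R) (k : nat) : R :=
  sup [set r | exists i j (w : walk i j), walk_length w = k /\
               r = op_norm (@nu i) (@nu j) (wprod xi w) `^ (k%:R^-1)].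

Arguments max_growth {R G} xi nu.

(* The limit exists and is the same for all multinorms, so [get] picks the only
   element of this set. *)
Definition joint_spectral_radius (R : realType) (G : multigraph)
    (xi : triplet R G) : R :=
  get [set r : R | forall nu : (forall i, lspace xi i -> R),
                     is_multinorm xi nu -> max_growth xi nu @ \oo --> r].

Definition convex_hull (R : realType) (V : vectType R) (s : seq V) : set V :=
  [set x | exists c : 'I_(size s) -> R,
     [/\ forall k, 0 <= c k, \sum_k c k = 1 & x = \sum_k c k *: s`_k]].

Definition is_polytope (R : realType) (V : vectType R) (P : set V) : Prop :=
  exists s : seq V, P = convex_hull s.

Definition polytope_multinorm (R : realType) (G : multigraph) (xi : triplet R G)
    (nu : forall i, lspace xi i -> R) : Prop :=
  is_multinorm xi nu /\ forall i, is_polytope [set x | nu i x <= 1].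

Arguments polytope_multinorm {R G} xi nu.

Definition barabanov (R : realType) (G : multigraph) (xi : triplet R G)
    (nu : forall i, lspace xi i -> R) : Prop :=
  forall i (x : lspace xi i),
    \big[Num.max/0]_(j < nvert G) \big[Num.max/0]_(e : edge i j) nu j (op xi e x)
    = joint_spectral_radius xi * nu i x.

Arguments barabanov {R G} xi nu.

(* Main.v *)
Require Import Defs.
From mathcomp Require Import all_boot all_order all_algebra.
From mathcomp Require Import all_classical all_reals all_analysis.
From mathcomp.real_closed Require Import complex.
From mathcomp Require Import perm ring lra zify.
Set Implicit Arguments.
Unset Strict Implicit.
Unset Printing Implicit Defensive.
Import Order.TTheory GRing.Theory Num.Theory.
Import numFieldNormedType.Exports.
Import passmx.
Local Open Scope classical_set_scope.
Local Open Scope ring_scope.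

(** The operators are divided by rho(Pi_a)^(1/|a|), where a is the dominant closed
    walk, based at i. Then Pi_a has a simple leading eigenvalue sg, which is 1 or -1.
    Let phi be a functional on L_i with phi o Pi_a = sg phi. The multinorm is
    [[
      nu_j(x) = max |phi(Pi_w x)|   over the walks w from j to i.
    ]]
    If the maximum exists, the Barabanov identity with constant 1 is built in: a
    nonempty walk starts with an edge, and the empty walk may be replaced by a. The
    kernels of the nu_j form an invariant family of subspaces, not all of them full
    since phi is nonzero, so by irreducibility nu is a multinorm. If moreover the maximum
    is taken over a finite set of walks, the unit balls are bounded intersections of
    finitely many half-spaces, hence polytopes ([polytope_of_bounded]). Finally, a
    multinorm satisfying a Barabanov identity computes the joint spectral radius
    ([jsr_of_barabanov]); undoing the normalization gives the theorem.

    Two facts about the normalized operators remain. Both rest on an argument of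
    Elsner ([near_return]): along a long product whose values neither blow up nor
    vanish two intermediate values are close, the product between them nearly fixes a
    vector, and therefore it has an eigenvalue near 1.

    First, the products are bounded ([bounded_of_spec]). Consider the largest scaling
    of the operators that keeps them bounded. By irreducibility the products are still
    bounded at this scaling, and they do not decay; so some closed walk has spectral
    radius close to 1 after the scaling. Since without scaling all spectral radii are
    at most 1, the scaling is at least 1.

    Second, finitely many walks suffice ([finite_maximum]). Copies of a at the end of w
    do not change |phi(Pi_w x)|. If w is long, does not end with a, and phi o Pi_w is
    not small, then by dominance the nearly closed piece of w is a high power of a
    cyclic permutation of a. Up to sign, a high power of Pi_a is close to a projection
    of rank one, so that phi o Pi_w is close to kappa times the functional of a shorter walk.
    The number kappa is nearly an eigenvalue of the product of a closed walk which is
    not a power of a cyclic permutation of a, so |kappa| is at most the constant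
    q < 1 of dominance. Hence long walks contribute at most q' nu(x) for some q' < 1.

    To work with words and square matrices, the spaces L_i are placed side by side in
    one direct sum, where products along sequences of edges that are not walks are
    zero and those along walks that are not closed are nilpotent ([emx],
    [spec_word]). *)

(** * An entrywise matrix norm *)

Section MatrixNorm.
Variable R : realType.

(** The entrywise l1 norm: it is submultiplicative for rectangular matrices with no
    dimensional constant. *)
Definition nm m n (M : 'M[R]_(m, n)) : R := \sum_i \sum_j `|M i j|.

Lemma nm_ge0 m n (M : 'M[R]_(m, n)) : 0 <= nm M.
Proof. by apply: sumr_ge0 => i _; apply: sumr_ge0 => j _. Qed.

Lemma nm_entry m n (M : 'M[R]_(m, n)) i j : `|M i j| <= nm M.
Proof.
rewrite /nm (bigD1 i) //= (bigD1 j) //= -addrA lerDl addr_ge0 //.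
  by apply: sumr_ge0.
by apply: sumr_ge0 => k _; apply: sumr_ge0.
Qed.

Lemma nm0_eq0 m n (M : 'M[R]_(m, n)) : nm M = 0 -> M = 0.
Proof.
move=> M0; apply/matrixP => i j; rewrite mxE; apply/eqP.
by rewrite -normr_le0 -M0 nm_entry.
Qed.

Lemma nm_gt0 m n (M : 'M[R]_(m, n)) : M != 0 -> 0 < nm M.
Proof.
move=> M0; rewrite lt0r nm_ge0 andbT.
by apply: contra M0 => /eqP /nm0_eq0 ->.
Qed.

Lemma nmZ m n c (M : 'M[R]_(m, n)) : nm (c *: M) = `|c| * nm M.
Proof.
rewrite /nm mulr_sumr; apply: eq_bigr => i _; rewrite mulr_sumr.
by apply: eq_bigr => j _; rewrite mxE normrM.
Qed.

Lemma nm0 m n : nm (0 : 'M[R]_(m, n)) = 0.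
Proof. by rewrite -(scale0r (0 : 'M[R]_(m, n))) nmZ normr0 mul0r. Qed.

Lemma nmN m n (M : 'M[R]_(m, n)) : nm (- M) = nm M.
Proof. by rewrite -scaleN1r nmZ normrN1 mul1r. Qed.

Lemma nmD m n (M N : 'M[R]_(m, n)) : nm (M + N) <= nm M + nm N.
Proof.
rewrite /nm -big_split /=; apply: ler_sum => i _.
by rewrite -big_split /=; apply: ler_sum => j _; rewrite mxE ler_normD.
Qed.

Lemma nmM m n p (M : 'M[R]_(m, n)) (N : 'M[R]_(n, p)) :
  nm (M *m N) <= nm M * nm N.
Proof.
rewrite /nm mulr_suml; apply: ler_sum => i _.
rewrite mulr_suml.
apply: (@le_trans _ _ (\sum_k \sum_j `|M i j| * `|N j k|)).
  apply: ler_sum => k _; rewrite mxE (le_trans (ler_norm_sum _ _ _)) //.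
  by apply: ler_sum => j _; rewrite normrM.
rewrite exchange_big /=; apply: ler_sum => j _.
rewrite -mulr_sumr ler_wpM2l // (bigD1 j) //= lerDl.
by apply: sumr_ge0 => k _; apply: sumr_ge0.
Qed.

Lemma nm_le m n (M : 'M[R]_(m, n)) e :
  (forall i j, `|M i j| <= e) -> nm M <= (m * n)%:R * e.
Proof.
move=> H; apply: (@le_trans _ _ (\sum_(i < m) \sum_(j < n) e)).
  by apply: ler_sum => i _; apply: ler_sum => j _.
by rewrite !sumr_const !card_ord -mulrnA mulr_natl mulnC.
Qed.

Lemma det_le n (M : 'M[R]_n) (c : R) :
  (forall i j, `|M i j| <= c) -> `|\det M| <= n`!%:R * c ^+ n.
Proof.
move=> H; rewrite /determinant (le_trans (ler_norm_sum _ _ _)) //.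
apply: (@le_trans _ _ (\sum_(s : {perm 'I_n}) c ^+ n)).
  apply: ler_sum => s _; rewrite normrM normrX normrN1 expr1n mul1r normr_prod.
  have -> : c ^+ n = \prod_(i < n) c by rewrite prodr_const card_ord.
  by apply: ler_prod => i _; rewrite normr_ge0 H.
by rewrite sumr_const card_Sn mulr_natl.
Qed.

(** The entries of the adjugate are polynomials in those of the matrix. This turns
    the identity adj(B) B F = det(B) F into a bound on det(B) when B F is small. *)
Lemma adj_bound n (c : R) : 0 <= c -> exists C, forall M : 'M[R]_n,
  nm M <= c -> nm (\adj M) <= C.
Proof.
move=> c0; exists ((n * n)%:R * (n.-1`!%:R * c ^+ n.-1)) => M Mc.
apply: nm_le => i j; rewrite !mxE /cofactor normrM normrX normrN1 expr1n mul1r.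
by apply: det_le => k l; rewrite !mxE (le_trans _ Mc) // nm_entry.
Qed.

End MatrixNorm.

(** * Spectral bounds and near eigenvectors *)

Section Spectrum.
Variable R : realType.

(** An upper bound on the moduli of the eigenvalues; unlike the supremum defining
    the spectral radius, it needs no side condition on the spectrum. *)
Definition spec_le n (M : 'M[R]_n) (r : R) : Prop :=
  forall l : R[i], eigenvalue (map_mx (real_complex R) M) l ->
  Normc.normc l <= r.

Lemma normc_ge0 (z : R[i]) : 0 <= Normc.normc z.
Proof. by case: z => a b /=; apply: sqrtr_ge0. Qed.

Lemma normc_real (c : R) : Normc.normc (real_complex R c) = `|c|.
Proof. by rewrite /= expr0n /= addr0 sqrtr_sqr. Qed.

Lemma normc_distl (x y : R[i]) :
  Normc.normc x - Normc.normc y <= Normc.normc (x - y).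
Proof.
by have := le_normcD (x - y) y; rewrite subrK lerBlDr.
Qed.

Lemma normc_prod (s : seq R[i]) (f : R[i] -> R[i]) :
  Normc.normc (\prod_(z <- s) f z) = \prod_(z <- s) Normc.normc (f z).
Proof.
elim: s => [|z s IH]; first by rewrite !big_nil Normc.normc1.
by rewrite !big_cons Normc.normcM IH.
Qed.

Lemma normcX (z : R[i]) k : Normc.normc (z ^+ k) = Normc.normc z ^+ k.
Proof.
elim: k => [|k IH]; first by rewrite !expr0 Normc.normc1.
by rewrite !exprS Normc.normcM IH.
Qed.

(** The determinant is the product of the differences of c and the eigenvalues. *)
Lemma det_shift_ge n (M : 'M[R]_n) c r : spec_le M r -> r <= `|c| ->
  (`|c| - r) ^+ n <= `|\det (M - c%:M)|.
Proof.
move=> Mr rc; set CM := map_mx (real_complex R) M.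
have [rs Ers] := closed_field_poly_normal (char_poly CM).
rewrite (monicP (char_poly_monic CM)) scale1r in Ers.
have Hdet : real_complex R (\det (c%:M - M)) =
            \prod_(z <- rs) (real_complex R c - z).
  transitivity (char_poly CM).[real_complex R c].
    rewrite -map_char_poly horner_map /= /char_poly.
    congr (real_complex R _); rewrite -horner_evalE -det_map_mx.
    congr (\det _); apply/matrixP => i j; rewrite !mxE /horner_eval.
    by rewrite /= /horner_eval hornerD hornerN hornerC hornerMn hornerX.
  by rewrite Ers horner_prod; apply: eq_bigr => z _; rewrite hornerXsubC.
have -> : `|\det (M - c%:M)| = `|\det (c%:M - M)|.
  by rewrite -opprB -scaleN1r detZ normrM normrX normrN1 expr1n mul1r.
rewrite -[leRHS]normc_real Hdet normc_prod.
have -> : n = size rs.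
  apply/eqP; rewrite -eqSS -(size_char_poly CM) Ers.
  by rewrite size_prod_XsubC.
have -> : (`|c| - r) ^+ size rs = \prod_(z <- rs) (`|c| - r).
  by rewrite big_const_seq count_predT iter_mulr_1.
rewrite !big_seq; apply: ler_prod => z zrs; rewrite subr_ge0 rc /=.
apply: le_trans (normc_distl _ _); rewrite normc_real lerB //.
apply: Mr; rewrite eigenvalue_root_char Ers root_prod_XsubC //.
Qed.

(** If P nearly multiplies F by c, then c is near the spectrum: F times det(P - c)
    equals adj(P - c) (P F - c F), so det(P - c) is small, whereas it is at least
    g ^+ n when |c| exceeds all moduli of eigenvalues by g. The bound on P makes e
    independent of P. *)
Lemma near_eigen n p (C eta g : R) : 0 <= C -> 0 < eta -> 0 < g ->
  exists2 e : R, 0 < e & forall (P : 'M[R]_n) (F : 'M[R]_(n, p)) c r,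
    nm P <= C -> `|c| <= C -> eta <= nm F -> nm (P *m F - c *: F) <= e ->
    spec_le P r -> `|c| < r + g.
Proof.
move=> C0 eta0 g0.
have [K HK] := @adj_bound R n (C + (n * n)%:R * C)
  (addr_ge0 C0 (mulr_ge0 (ler0n _ _) C0)).
exists (g ^+ n * eta / (`|K| + 1) / 2).
  by rewrite !divr_gt0 ?mulr_gt0 ?exprn_gt0 // ltr_wpDl.
move=> P F c r PC cC Feta He Pr; rewrite ltNge; apply/negP => rc.
have PcK : nm (\adj (P - c%:M)) <= `|K| + 1.
  rewrite (@le_trans _ _ `|K|) ?lerDl // (le_trans _ (ler_norm K)) //.
  apply: HK; rewrite (le_trans (nmD _ _)) // lerD // nmN.
  apply: nm_le => i j; rewrite mxE; case: (i == j); rewrite ?mulr1n //.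
  by rewrite mulr0n normr0.
have E : \det (P - c%:M) *: F = \adj (P - c%:M) *m (P *m F - c *: F).
  rewrite -[c *: F]mul_scalar_mx -mulmxBl mulmxA mul_adj_mx.
  by rewrite mul_scalar_mx.
have D1 : g ^+ n <= `|\det (P - c%:M)|.
  apply: le_trans (det_shift_ge Pr _).
    have gr : g <= `|c| - r by rewrite lerBrDl.
    by rewrite lerXn2r // nnegrE ?(le_trans _ gr) // ltW.
  by rewrite (le_trans _ rc) // lerDl ltW.
have : g ^+ n * eta <= g ^+ n * eta / 2.
  apply: (@le_trans _ _ (`|\det (P - c%:M)| * nm F)).
    by apply: ler_pM => //; rewrite ?exprn_ge0 ?ltW.
  rewrite -nmZ E (le_trans (nmM _ _)) //.
  apply: (@le_trans _ _ ((`|K| + 1) * (g ^+ n * eta / (`|K| + 1) / 2))).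
    by apply: ler_pM => //; apply: nm_ge0.
  rewrite le_eqVlt; apply/orP; left; apply/eqP; field.
  by rewrite gt_eqF // ltr_wpDl.
apply/negP; rewrite -ltNge.
by rewrite gtr_pMr ?mulr_gt0 ?exprn_gt0 // invf_lt1 // ltr1n.
Qed.

Lemma eigenvalue_prod_shift (F : fieldType) n (M : 'M[F]_n) rs (x : 'rV_n) :
  x != 0 -> x *m (\big[mulmx/1%:M]_(z <- rs) (M - z%:M)) = 0 ->
  exists2 z, z \in rs & eigenvalue M z.
Proof.
elim: rs x => [|z rs IH] x x0.
  by rewrite big_nil mulmx1 => /eqP; rewrite (negPf x0).
rewrite big_cons mulmxA => H.
have [E|E] := eqVneq (x *m (M - z%:M)) 0.
  exists z; first by rewrite inE eqxx.
  apply/eigenvalueP; exists x => //; apply/eqP.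
  by rewrite -mul_mx_scalar -subr_eq0 -mulmxBr E.
have [z' zs ez] := IH _ E H.
by exists z' => //; rewrite inE zs orbT.
Qed.

(** Factor X^k - l over the closed field: a vector killed by M^k - l is killed by
    a product of shifts M - z with z^k = l, so one of them is singular. *)
Lemma eigenvalue_exp (F : closedFieldType) n (M : 'M[F]_n) k l :
  (0 < k)%N -> eigenvalue (M ^+ k) l -> exists2 z, eigenvalue M z & l = z ^+ k.
Proof.
case: n M => [|n] M k0 /eigenvalueP [x Ex x0].
  by case/eqP: x0; apply/rowP => -[].
have [rs Ers] := closed_field_poly_normal ('X^k - l%:P).
rewrite lead_coefDl ?size_polyXn ?size_polyN
  ?(leq_ltn_trans (size_polyC_leq1 _)) // in Ers.
rewrite lead_coefXn scale1r in Ers.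
have [z zrs ez] : exists2 z, z \in rs & eigenvalue M z.
  apply: (eigenvalue_prod_shift x0).
  transitivity (x *m horner_mx M ('X^k - l%:P)).
    congr (_ *m _); rewrite Ers rmorph_prod /=.
    apply: eq_bigr => z _; by rewrite rmorphB /= horner_mx_X horner_mx_C.
  rewrite rmorphB /= rmorphXn /= horner_mx_X horner_mx_C mulmxBr Ex.
  by rewrite mul_mx_scalar subrr.
exists z => //; apply/eqP.
have : root ('X^k - l%:P) z by rewrite Ers root_prod_XsubC.
by rewrite rootE hornerD hornerN hornerXn hornerC subr_eq0 eq_sym.
Qed.

Lemma spec_leX n (M : 'M[R]_n) r k : (0 < k)%N -> 0 <= r ->
  spec_le M r -> spec_le (M ^+ k) (r ^+ k).
Proof.
move=> k0 r0 Mr l; rewrite rmorphXn /= => /(eigenvalue_exp k0) [z ez ->].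
by rewrite normcX lerXn2r ?nnegrE ?normc_ge0 // Mr.
Qed.

End Spectrum.

(** * Words of operators and near returns *)

Section Words.
Variable R : realType.

(** Round the entries to multiples of a small d: matrices with the same rounding
    are close, and the number of roundings depends only on C, e and
    the size of the matrices. *)
Lemma pigeonhole m n (C e : R) : 0 < e -> exists K, forall F : nat -> 'M[R]_(m, n),
  (forall k, (k <= K)%N -> nm (F k) <= C) ->
  exists k l, [/\ (k < l)%N, (l <= K)%N & nm (F l - F k) <= e].
Proof.
move=> e0.
pose d := e / (m * n).+1%:R.
have d0 : 0 < d by rewrite divr_gt0.
pose N := Num.truncn ((C + C) / d).
pose T := {ffun 'I_m * 'I_n -> 'I_N.+1}.
exists #|T| => F HF.
pose g (k : 'I_#|T|.+1) : T := [ffun ij => inord (Num.truncn ((F k ij.1 ij.2 + C) / d))].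
have Hb (k : 'I_#|T|.+1) i j : 0 <= (F k i j + C) / d <= (C + C) / d.
  have /HF Fk : (k <= #|T|)%N by rewrite -ltnS.
  have := le_trans (nm_entry (F k) i j) Fk; rewrite ler_norml => /andP [h1 h2].
  apply/andP; split; first by rewrite divr_ge0 ?(ltW d0) // -lerBlDr sub0r.
  by rewrite ler_pM2r ?invr_gt0 // lerD2r.
have [k [l [kl gkl]]] : exists k l : 'I_#|T|.+1, (k < l)%N /\ g k = g l.
  apply: contrapT => H.
  have inj : injective g.
    move=> k l gkl; apply: contrapT => kl; apply: H.
    case: (ltngtP k l) => h; first by exists k, l.
      by exists l, k.
    by case: kl; apply: val_inj.
  by have := leq_card g inj; rewrite card_ord ltnn.
exists k, l; split => //; first by rewrite -ltnS.
rewrite (le_trans (@nm_le _ _ _ _ d _)) //; last first.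
  rewrite /d mulrCA ger_pMr // ler_pdivrMr // mul1r ler_nat.
  exact: leqnSn.
move=> i j; rewrite !mxE.
have /ffunP /(_ (i, j)) := gkl; rewrite !ffunE /= => /(congr1 val) /=.
have /andP [hk0 hkN] := Hb k i j; have /andP [hl0 hlN] := Hb l i j.
rewrite !inordK ?ltnS ?le_truncn // => E.
have := truncn_itv hk0; have := truncn_itv hl0; rewrite -E => /andP [a1 a2] /andP [b1 b2].
have -> : F l i j - F k i j = ((F l i j + C) / d - (F k i j + C) / d) * d.
  by rewrite -mulrBl mulfVK ?gt_eqF // opprD addrACA subrr addr0.
rewrite normrM (gtr0_norm d0) ger_pMl // ler_norml.
move: a1 a2 b1 b2; rewrite -[X in _ < X%:R]addn1 natrD.
by move=> *; apply/andP; split; lra.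
Qed.

Variables (E : Type) (D : nat).
Implicit Types (A : E -> 'M[R]_D) (s : seq E).

(** Operators act on row vectors from the right, so that the letters of a word
    are applied in reading order. *)
Definition wmx A s : 'M[R]_D := \big[mulmx/1%:M]_(e <- s) A e.

Lemma wmx_nil A : wmx A [::] = 1%:M.
Proof. exact: big_nil. Qed.

Lemma wmx_cons A e s : wmx A (e :: s) = A e *m wmx A s.
Proof. exact: big_cons. Qed.

Lemma wmx_cat A s t : wmx A (s ++ t) = wmx A s *m wmx A t.
Proof.
elim: s => [|e s IH] /=; first by rewrite wmx_nil mul1mx.
by rewrite !wmx_cons IH mulmxA.
Qed.

Lemma wmx_seq1 A e : wmx A [:: e] = A e.
Proof. by rewrite wmx_cons wmx_nil mulmx1. Qed.

Lemma wmx_rcons A s e : wmx A (rcons s e) = wmx A s *m A e.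
Proof. by rewrite -cats1 wmx_cat wmx_seq1. Qed.

Lemma wmx_flatten_nseq A m s : wmx A (flatten (nseq m s)) = wmx A s ^+ m.
Proof.
elim: m => [|m IH]; first by rewrite /= wmx_nil expr0.
by rewrite /= wmx_cat IH exprS.
Qed.

Lemma wmxZ A c s : wmx (fun e => c *: A e) s = c ^+ size s *: wmx A s.
Proof.
elim: s => [|e s IH]; first by rewrite !wmx_nil scale1r.
by rewrite !wmx_cons IH -scalemxAl -scalemxAr scalerA exprS.
Qed.

(** Elsner's argument. Cut a long word s at distances 0, L, 2L, ... from its end
    and apply the suffixes to F. The results stay in a bounded region, away from 0
    since the whole word does not shrink F. Two of them are close, so the factor b
    between the two cuts nearly fixes a matrix that is not small, and b has an
    eigenvalue near 1 by [near_eigen]. *)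
Lemma near_return A C p C0 eta r L :
  (forall s, nm (wmx A s) <= C) -> 0 < eta -> r < 1 ->
  exists K, forall s (F : 'M[R]_(D, p)), (K <= size s)%N -> nm F <= C0 ->
    eta <= nm (wmx A s *m F) ->
    exists s1 b u, [/\ s = s1 ++ b ++ u, (L <= size b)%N & ~ spec_le (wmx A b) r].
Proof.
move=> AC eta0 r1.
have C_ge0 : 0 <= C := le_trans (nm_ge0 _) (AC [::]).
have eta'0 : 0 < eta / (C + 1) by rewrite divr_gt0 // ltr_wpDl.
have [e e0 He] := @near_eigen R D p (C + 1) (eta / (C + 1)) (1 - r)
  (addr_ge0 C_ge0 ler01) eta'0 (ltac:(by rewrite subr_gt0)).
have [M HM] := @pigeonhole D p (C * C0) e e0.
exists (M * L)%N => s F sK FC0 Fs.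
have [|k [l [kl lM Hkl]]] := HM (fun k => wmx A (drop (size s - k * L) s) *m F).
  move=> k _; rewrite (le_trans (nmM _ _)) // ler_pM ?nm_ge0 //.
have lK : (l * L <= size s)%N by rewrite (leq_trans _ sK) // leq_mul2r lM orbT.
have kK : (k * L + L <= l * L)%N by rewrite addnC -mulSn leq_mul2r kl orbT.
set s1 := take (size s - l * L) s.
set w := drop (size s - l * L) s in Hkl *.
have Ew : w = take (l * L - k * L) w ++ drop (size s - k * L) s.
  rewrite -{1}[w](cat_take_drop (l * L - k * L)); congr (_ ++ _).
  by rewrite /w drop_drop; congr (drop _ _); lia.
exists s1, (take (l * L - k * L) w), (drop (size s - k * L) s); split.
- by rewrite -Ew cat_take_drop.
- rewrite size_takel; first by lia.
  by rewrite size_drop; lia.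
- set b := take _ _ => Hb; set u := drop (size s - k * L) s in Ew Hkl *.
  (* the eigenvalue is c = 1 and the margin is g = 1 - r *)
  have : `|1 : R| < r + (1 - r).
    apply: (He (wmx A b) (wmx A u *m F)) => //.
    + by rewrite (le_trans (AC _)) // lerDl.
    + by rewrite normr1 lerDr.
    + rewrite ler_pdivrMr ?ltr_wpDl // mulrC.
      have Es : s = (s1 ++ b) ++ u by rewrite -catA -Ew cat_take_drop.
      rewrite (le_trans Fs) // {1}Es wmx_cat -mulmxA (le_trans (nmM _ _)) //.
      by rewrite ler_wpM2r ?nm_ge0 // (le_trans (AC _)) // lerDl.
    + by rewrite scale1r mulmxA -wmx_cat -Ew.
  by rewrite normr1 addrC subrK ltxx.
Qed.

End Words.

(** * Compactness of the unit sphere and comparison of norms *)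

Section Compactness.
Variable R : realType.

Definition lipschitz D (g : 'rV[R]_D -> R) :=
  exists C, forall x y, `|g x - g y| <= C * nm (x - y).

Lemma open_lipschitz D (g : 'rV[R]_D -> R) : lipschitz g ->
  open [set x | 0 < g x].
Proof.
move=> [C HC]; rewrite openE => x /= gx.
have C'0 : 0 < (`|C| + 1) * D.+1%:R by rewrite mulr_gt0 // ltr_wpDl.
apply/nbhs_ballP; exists (g x / ((`|C| + 1) * D.+1%:R)); first exact: divr_gt0.
move=> y [_ Hy] /=; have := HC x y.
have Hd : nm (x - y) <= (1 * D)%:R * (g x / ((`|C| + 1) * D.+1%:R)).
  apply: nm_le => i j; rewrite !mxE.
  by have /ltW := Hy i j.
rewrite mul1n in Hd.
have H2 : C * nm (x - y) < g x.
  apply: (@le_lt_trans _ _ ((`|C| + 1) * (D%:R * (g x / ((`|C| + 1) * D.+1%:R))))).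
    apply: (@le_trans _ _ ((`|C| + 1) * nm (x - y))).
      by rewrite ler_wpM2r ?nm_ge0 // (le_trans (ler_norm _)) // lerDl.
    by rewrite ler_wpM2l // addr_ge0.
  have a0 : `|C| + 1 != 0 by rewrite gt_eqF // ltr_wpDl.
  have b0 : D.+1%:R != 0 :> R by rewrite pnatr_eq0.
  have alg (a b u v : R) : a != 0 -> b != 0 ->
      a * (u * (v / (a * b))) = v * (u / b).
    by move=> ha hb; field; rewrite ha hb.
  by rewrite alg // gtr_pMr // ltr_pdivrMr // mul1r ltr_nat.
rewrite ler_norml => /andP [_ h].
have := le_lt_trans h H2; lra.
Qed.

Lemma lipschitz_nm D : lipschitz (@nm R 1 D).
Proof.
exists 1 => x y; rewrite mul1r ler_norml.
have := nmD (x - y) y; have := nmD (y - x) x; rewrite !subrK -(opprB x y) nmN.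
by move=> h1 h2; apply/andP; split; lra.
Qed.

Lemma compact_sphere D : compact [set x : 'rV[R]_D | nm x = 1].
Proof.
apply: bounded_closed_compact.
  exists 1; split => // M M1 x /= nx.
  rewrite (le_trans _ (ltW M1)) // -nx [leLHS]/Num.norm /= mx_normrE.
  by apply/bigmax_leP; split; [exact: nm_ge0|move=> ij _; exact: nm_entry].
have -> : [set x : 'rV[R]_D | nm x = 1] = ~` [set x | 0 < `|nm x - 1|].
  apply/seteqP; split => x /=; first by move=> ->; rewrite subrr normr0 ltxx.
  by move=> /negP; rewrite normr_gt0 negbK subr_eq0 => /eqP.
apply: open_closedC; apply: open_lipschitz.
have [C HC] := lipschitz_nm D; exists C => x y.
apply: le_trans (HC x y); rewrite (le_trans (ler_dist_dist _ _)) //.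
by rewrite opprB addrA subrK.
Qed.

(** The sets where g i is positive are open and cover the compact sphere. *)
Lemma sphere_cover D (I : choiceType) (g : I -> 'rV[R]_D -> R) :
  (forall i, lipschitz (g i)) ->
  (forall x, nm x = 1 -> exists i, 0 < g i x) ->
  exists s : seq I, forall x, nm x = 1 -> exists2 i, i \in s & 0 < g i x.
Proof.
move=> gl gx; have := @compact_sphere D; rewrite compact_cover.
move=> /(_ I setT (fun i => [set x | 0 < g i x])) [].
- by move=> i _; exact: open_lipschitz.
- by move=> x /= /gx [i gi]; exists i.
- by move=> s _ Hs; exists (finmap.enum_fset s) => x /Hs [i /= si gi]; exists i.
Qed.

Lemma norm_upper D (N : 'rV[R]_D -> R) :
  (forall c x, N (c *: x) = `|c| * N x) -> (forall x y, N (x + y) <= N x + N y) ->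
  exists C, forall x, N x <= C * nm x.
Proof.
move=> NZ ND; have N0 : N 0 = 0 by rewrite -(scale0r 0) NZ normr0 mul0r.
have Npos x : 0 <= N x.
  have := ND x (- x); rewrite subrr N0 -scaleN1r NZ normrN1 mul1r; lra.
exists (\sum_i N (delta_mx 0 i)) => x.
rewrite [x in N x]row_sum_delta mulr_suml.
apply: (@le_trans _ _ (\sum_i N (x 0 i *: delta_mx 0 i))).
  elim/big_ind2 : _ => // [|a b c d h1 h2]; first by rewrite N0.
  by rewrite (le_trans (ND _ _)) // lerD.
by apply: ler_sum => i _; rewrite NZ mulrC ler_wpM2l // nm_entry.
Qed.

(** Finitely many of the open sets N > 1/(n+1) cover the unit sphere. *)
Lemma norm_lower D (N : 'rV[R]_D -> R) :
  (forall c x, N (c *: x) = `|c| * N x) -> (forall x y, N (x + y) <= N x + N y) ->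
  (forall x, 0 <= N x) -> (forall x, N x = 0 -> x = 0) ->
  exists2 c, 0 < c & forall x, c * nm x <= N x.
Proof.
move=> NZ ND N0 Nx.
have [C HC] := norm_upper NZ ND.
have Nl : forall n : nat, lipschitz (fun x => N x - n.+1%:R^-1).
  move=> n; exists C => x y; rewrite opprB addrA subrK.
  apply: le_trans (HC _); rewrite ler_norml.
  have NN z : N (- z) = N z by rewrite -scaleN1r NZ normrN1 mul1r.
  have := ND (x - y) y; have := ND (y - x) x; rewrite !subrK -(opprB x y) NN.
  by move=> h1 h2; apply/andP; split; lra.
have [x nx|s Hs] := sphere_cover Nl.
  have Nx0 : 0 < N x.
    rewrite lt0r N0 andbT; apply/eqP => /Nx x0.
    by move: nx; rewrite x0 nm0 => /eqP; rewrite eq_sym oner_eq0.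
  exists (Num.truncn (N x)^-1); rewrite subr_gt0.
  rewrite -[ltRHS]invrK ltf_pV2 ?posrE ?invr_gt0 //.
  by rewrite truncnS_gt.
pose c := (\max_(i <- s) i).+1%:R^-1 : R.
have c0 : 0 < c by rewrite invr_gt0.
exists c => // x; have [->|x0] := eqVneq x 0; first by rewrite nm0 mulr0.
have nx := nm_gt0 x0.
have [|i si] := Hs ((nm x)^-1 *: x).
  by rewrite nmZ gtr0_norm ?invr_gt0 // mulVf ?gt_eqF.
rewrite subr_gt0 NZ gtr0_norm ?invr_gt0 // => /ltW H.
rewrite -ler_pdivlMr // mulrC (le_trans _ H) // lef_pV2 ?posrE // ler_nat.
by rewrite ltnS; exact: (@leq_bigmax_seq _ s xpredT (fun i => i)).
Qed.

End Compactness.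

(** * Boundedness of the products *)

Section Bounded.
Variables (R : realType) (E : finType) (D : nat).
Implicit Types (A : E -> 'M[R]_D) (s : seq E).

(** Irreducibility in terms of predicates on the total space. Invariance is
    required as an equivalence: x belongs to P as soon as all its images do. On the
    direct sum of the spaces of a triplet this forces P to be a sum of subspaces of
    the summands, since the components of x have the same images as x or zero
    images. *)
Definition irreducible_family A := forall P : 'rV[R]_D -> Prop,
  P 0 -> (forall c x y, P x -> P y -> P (c *: x + y)) ->
  (forall x, P x <-> forall e, P (x *m A e)) ->
  (forall x, P x -> x = 0) \/ (forall x, P x).

Lemma bernoulli_ineq (d : R) k : -1 <= d -> 1 + k%:R * d <= (1 + d) ^+ k.
Proof.
move=> d1; elim: k => [|k IH]; first by rewrite mul0r addr0 expr0.
rewrite exprS; apply: (@le_trans _ _ ((1 + d) * (1 + k%:R * d))).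
  have := sqr_ge0 d; have := ler0n R k; rewrite -natr1 => k0 d20.
  have : 0 <= k%:R * d ^+ 2 by rewrite mulr_ge0.
  rewrite expr2; lra.
by rewrite ler_wpM2l // -lerBlDl sub0r.
Qed.

Definition bounded A := exists C, forall s, nm (wmx A s) <= C.

Lemma nm_rows (M : 'M[R]_D) : nm M = \sum_i nm (delta_mx 0 i *m M : 'rV_D).
Proof.
apply: eq_bigr => i _; rewrite /nm big_ord1; apply: eq_bigr => j _.
by rewrite -rowE mxE.
Qed.

(** The vectors with bounded orbits form an invariant subspace. If it is everything,
    the products are bounded. If it is zero, every unit vector is expanded by some
    product, and by compactness of the sphere by one of a finite list. *)
Lemma bounded_or_expanding A : irreducible_family A ->
  bounded A \/ exists W : seq (seq E), forall x : 'rV[R]_D, nm x = 1 ->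
    exists2 s, s \in W & 2 < nm (x *m wmx A s).
Proof.
move=> irrA.
pose P (x : 'rV[R]_D) := exists C, forall s, nm (x *m wmx A s) <= C.
have [||x|P0|PT] := irrA P.
- by exists 0 => s; rewrite mul0mx nm0.
- move=> c x y [C HC] [C' HC']; exists (`|c| * C + C') => s.
  rewrite mulmxDl (le_trans (nmD _ _)) // lerD // -scalemxAl nmZ.
  by rewrite ler_wpM2l.
- split=> [[C HC] e|H]; first by exists C => s; rewrite -mulmxA -wmx_cons.
  have [C HC] := choice H.
  exists (nm x + \sum_e C e) => -[|e s].
    rewrite wmx_nil mulmx1 lerDl sumr_ge0 // => e _.
    exact: le_trans (nm_ge0 _) (HC e [::]).
  rewrite wmx_cons mulmxA (le_trans (HC e s)) // (bigD1 e) //= addrCA lerDl.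
  rewrite addr_ge0 ?nm_ge0 // sumr_ge0 // => e' _.
  exact: le_trans (nm_ge0 _) (HC e' [::]).
- right.
  have [s|x nx|W HW] := @sphere_cover R D (seq E) (fun s x => nm (x *m wmx A s) - 2).
  + exists (nm (wmx A s)) => x y; rewrite opprB addrA subrK.
    have [C HC] := lipschitz_nm R D.
    have := nmD (x *m wmx A s - y *m wmx A s) (y *m wmx A s).
    have := nmD (y *m wmx A s - x *m wmx A s) (x *m wmx A s).
    rewrite !subrK -(opprB (x *m _)) nmN -mulmxBl.
    have := nmM (x - y) (wmx A s).
    rewrite ler_norml mulrC => h1 h2 h3; apply/andP; split; lra.
  + apply: contrapT => H; have : P x.
      exists 2 => s; rewrite leNgt; apply/negP => h.
      by apply: H; exists s; rewrite subr_gt0.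
    by move=> /P0 x0; move: nx; rewrite x0 nm0 => /eqP; rewrite eq_sym oner_eq0.
  + by exists W => x /HW [s sW]; rewrite subr_gt0; exists s.
- left; have [C HC] := choice (fun i : 'I_D => PT (delta_mx 0 i)).
  by exists (\sum_i C i) => s; rewrite nm_rows; apply: ler_sum.
Qed.

Lemma expanding_unbounded A : (0 < D)%N ->
  (forall x : 'rV[R]_D, exists s, 3 / 2 * nm x <= nm (x *m wmx A s)) -> ~ bounded A.
Proof.
move=> D0 exA [C HC].
pose x0 : 'rV[R]_D := delta_mx 0 (Ordinal D0).
have nx0 : 0 < nm x0.
  apply: nm_gt0; apply/eqP => /rowP /(_ (Ordinal D0)).
  by rewrite !mxE !eqxx => /eqP; rewrite oner_eq0.
have orb n : exists s, (3 / 2) ^+ n * nm x0 <= nm (x0 *m wmx A s).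
  elim: n => [|n [s IH]]; first by exists [::]; rewrite expr0 mul1r wmx_nil mulmx1.
  have [s' Hs'] := exA (x0 *m wmx A s).
  exists (s ++ s'); rewrite wmx_cat mulmxA (le_trans _ Hs') // exprS -mulrA.
  by rewrite ler_wpM2l.
have [s Hs] := orb (Num.truncn (2 * C)).+1.
have := le_trans Hs (nmM _ _); rewrite mulrC ler_pM2l // => H.
have := le_trans H (HC s).
have -> : 3 / 2 = 1 + 2^-1 :> R by lra.
move=> H2; have := le_trans (@bernoulli_ineq 2^-1 _ (ltac:(lra))) H2.
have := truncnS_gt (2 * C).
lra.
Qed.

(** A word is a concatenation of blocks of length k and a shorter remainder. *)
Lemma bounded_blocks A k : (0 < k)%N ->
  (forall s, size s = k -> nm (wmx A s) <= 1) -> bounded A.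
Proof.
move=> k0 Hk; pose M := 1 + \sum_e nm (A e).
have M1 : 1 <= M by rewrite lerDl sumr_ge0 // => e _; exact: nm_ge0.
exists (nm (1%:M : 'M[R]_D) * M ^+ k) => s.
have [n] := ubnP (size s); elim: n s => // n IH s; rewrite ltnS => sn.
have [sk|sk] := ltnP (size s) k.
  apply: (@le_trans _ _ (nm (1%:M : 'M[R]_D) * M ^+ size s)); last first.
    by rewrite ler_wpM2l ?nm_ge0 // ler_weXn2l // ltnW.
  elim: s {sn sk} => [|e s IHs]; first by rewrite wmx_nil expr0 mulr1.
  rewrite wmx_cons (le_trans (nmM _ _)) // exprS mulrCA ler_pM ?nm_ge0 //.
  rewrite /M (bigD1 e) //= addrCA lerDl addr_ge0 // sumr_ge0 // => e' _.
  exact: nm_ge0.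
rewrite -(cat_take_drop k s) wmx_cat (le_trans (nmM _ _)) //.
rewrite -[leRHS]mul1r ler_pM ?nm_ge0 //; first by rewrite Hk // size_takel.
by apply: IH; rewrite size_drop; lia.
Qed.

Lemma spec_leZ (M : 'M[R]_D) c r : 0 < c -> spec_le M r -> spec_le (c *: M) (c * r).
Proof.
move=> c0 Mr l /eigenvalueP [v Ev v0].
have cC : real_complex R c != 0 by rewrite (fmorph_eq0 (real_complex R)) gt_eqF.
have /Mr : eigenvalue (map_mx (real_complex R) M) ((real_complex R c)^-1 * l).
  apply/eigenvalueP; exists v => //.
  by rewrite -scalerA -Ev map_mxZ -scalemxAr scalerA mulVf // scale1r.
rewrite Normc.normcM Normc.normcV normc_real gtr0_norm // => H.
by rewrite -ler_pdivrMl.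
Qed.

Lemma irreducible_familyZ A c : c != 0 ->
  irreducible_family A -> irreducible_family (fun e => c *: A e).
Proof.
move=> c0 irrA P P0 PL PA.
have PZ a x : P x -> P (a *: x) by move=> Px; rewrite -[a *: x]addr0; apply: PL.
apply: irrA => // x; rewrite PA; split=> H e.
  by rewrite -[x *m A e]scale1r -(mulVf c0) -scalerA scalemxAr; apply: PZ.
by rewrite -scalemxAr; apply: PZ.
Qed.

(** The Berger-Wang theorem for an irreducible family. Let ts be the supremum of
    the scalings t for which the products of the operators t A e are bounded. At ts
    they are still bounded: otherwise finitely many products expand every vector,
    with a factor that stays above 1 for t slightly smaller than ts. At ts the
    products of length k do not become small: otherwise a slightly larger t would
    be admissible. Then [near_return] gives a word whose product, scaled by ts, has
    an eigenvalue near 1. This is impossible for ts < 1, because the scaled product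
    of a nonempty word has its spectrum in the disc of radius ts. *)
Lemma bounded_of_spec A : irreducible_family A ->
  (forall s, s != [::] -> spec_le (wmx A s) 1) -> bounded A.
Proof.
move=> irrA specA; apply: contrapT => nbd.
pose B t := bounded (fun e => t *: A e).
have Bmono t t' : 0 <= t -> t <= t' -> B t' -> B t.
  move=> t0 tt' [C HC]; exists C => s; rewrite (le_trans _ (HC s)) // !wmxZ !nmZ.
  rewrite ler_wpM2r ?nm_ge0 // !ger0_norm ?exprn_ge0 ?(le_trans t0) //.
  by rewrite lerXn2r ?nnegrE ?(le_trans t0).
have B1 t : 0 <= t -> B t -> t < 1.
  move=> t0 Bt; rewrite ltNge; apply/negP => t1; apply: nbd.
  have [C HC] : B 1 by apply: Bmono Bt.
  by exists C => s; rewrite (le_trans _ (HC s)) // wmxZ expr1n scale1r.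
pose T := [set t : R | 0 < t /\ B t].
pose t0 : R := (1 + \sum_e nm (A e))^-1.
have S0 : 0 < 1 + \sum_e nm (A e).
  by rewrite ltr_wpDr // sumr_ge0 // => e _; exact: nm_ge0.
have Tt0 : T t0.
  split; first by rewrite invr_gt0.
  apply: (@bounded_blocks _ 1%N) => // -[|e []] // _; rewrite wmx_seq1 nmZ.
  rewrite gtr0_norm ?invr_gt0 // mulrC ler_pdivrMr // mul1r (bigD1 e) //= addrCA lerDl.
  by rewrite addr_ge0 // sumr_ge0 // => e' _; exact: nm_ge0.
have supT : has_sup T.
  by split; [exists t0|exists 1 => t [/ltW t_ge0 /(B1 _ t_ge0) /ltW]].
pose ts := sup T.
have ts0 : 0 < ts by apply: lt_le_trans (ub_le_sup supT.2 Tt0); case: Tt0.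
have D0 : (0 < D)%N.
  rewrite lt0n; apply/eqP => D0; apply: nbd; exists 0 => s.
  rewrite (_ : wmx A s = 0) ?nm0 //; apply/matrixP => i.
  by exfalso; move: (ltn_ord i); rewrite {2}D0.
have Bts : B ts.
  have [//|[W HW]] := bounded_or_expanding (irreducible_familyZ (lt0r_neq0 ts0) irrA).
  pose k := \max_(s <- W) size s.
  (* t / ts >= 1 - d gives (t / ts) ^+ size s >= 3/4 for s in W *)
  pose d : R := (4 * k.+1%:R)^-1.
  have d0 : 0 < d by rewrite invr_gt0 mulr_gt0.
  have d1 : k%:R * d <= 4^-1.
    rewrite /d invfM mulrCA ger_pMr // ler_pdivrMr // mul1r ler_nat.
    exact: leqnSn.
  have d2 : d <= 1.
    by rewrite invf_le1 ?mulr_gt0 // -natrM ler1n muln_gt0.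
  have [t [t_gt0 Bt] tt] := sup_adherent (mulr_gt0 ts0 d0) supT.
  have tts : t <= ts by apply: (ub_le_sup supT.2).
  have rt (x : 'rV[R]_D) : exists s, 3 / 2 * nm x <= nm (x *m wmx (fun e => t *: A e) s).
    have [->|x0] := eqVneq x 0; first by exists [::]; rewrite nm0 mulr0 nm_ge0.
    have nx := nm_gt0 x0.
    have [|s sW] := HW ((nm x)^-1 *: x).
      by rewrite nmZ gtr0_norm ?invr_gt0 // mulVf ?gt_eqF.
    rewrite -scalemxAl nmZ gtr0_norm ?invr_gt0 // ltr_pdivlMl // => H.
    exists s; move: H; rewrite !wmxZ -!scalemxAr !nmZ !gtr0_norm ?exprn_gt0 // => H.
    have sk : (size s <= k)%N by exact: (@leq_bigmax_seq _ W xpredT size).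
    have : 3 / 4 * ts ^+ size s <= t ^+ size s.
      have -> : t = (t / ts) * ts by rewrite mulfVK ?gt_eqF.
      rewrite exprMn ler_wpM2r ?exprn_ge0 ?(ltW ts0) //.
      have Hr : 1 - d <= t / ts by rewrite ler_pdivlMr // mulrBl mul1r mulrC ltW.
      apply: (@le_trans _ _ ((1 - d) ^+ size s)); last first.
        by rewrite lerXn2r ?nnegrE ?subr_ge0 // (le_trans _ Hr) ?subr_ge0.
      apply: (@le_trans _ _ (1 + (size s)%:R * - d)).
        have : (size s)%:R * d <= k%:R * d by rewrite ler_wpM2r ?(ltW d0) // ler_nat.
        lra.
      by apply: bernoulli_ineq; rewrite lerN2.
    have := nm_ge0 (x *m wmx A s).
    move=> y0 h.
    have : 3 / 4 * ts ^+ size s * nm (x *m wmx A s) <= t ^+ size s * nm (x *m wmx A s).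
      by rewrite ler_wpM2r.
    lra.
  by case: (expanding_unbounded D0 rt Bt).
have ts1 := B1 _ (ltW ts0) Bts.
have [C HC] := Bts.
have half0 : 0 < 2^-1 :> R by rewrite invr_gt0.
have [K HK] :=
  @near_return R E D _ C D (nm (1%:M : 'M[R]_D)) 2^-1 ts 1 HC half0 ts1.
have [s sK Hs] : exists2 s, size s = K.+1 & 2^-1 < nm (wmx (fun e => ts *: A e) s).
  apply: contrapT => H.
  (* (1 - d) ^+ K.+1 >= 1/2, so ts / (1 - d) is an admissible scaling *)
  pose d : R := (2 * K.+1%:R)^-1.
  have d0 : 0 < d by rewrite invr_gt0 mulr_gt0.
  have d1 : K.+1%:R * d = 2^-1 by rewrite /d invfM mulrCA mulfV ?mulr1 ?pnatr_eq0.
  have d2 : d < 1 by rewrite invf_lt1 ?mulr_gt0 // -natrM ltr1n; lia.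
  have d3 : 0 < 1 - d by rewrite subr_gt0.
  have : ts / (1 - d) <= ts.
    apply: (ub_le_sup supT.2); split; first by rewrite divr_gt0.
    apply: (@bounded_blocks _ K.+1) => // s sK; rewrite wmxZ sK exprMn nmZ.
    have {}H : nm (wmx (fun e => ts *: A e) s) <= 2^-1.
      by rewrite leNgt; apply/negP => h; apply: H; exists s.
    rewrite wmxZ sK nmZ gtr0_norm ?exprn_gt0 // in H.
    rewrite normrM !gtr0_norm ?exprn_gt0 ?invr_gt0 // mulrAC exprVn.
    rewrite ler_pdivrMr ?exprn_gt0 // mul1r (le_trans H) //.
    have := @bernoulli_ineq (- d) K.+1 (ltac:(by rewrite lerN2 ltW)); lra.
  by rewrite ler_pdivrMr // ler_pMr // lerBrDl => h; lra.
have [|||s1 [b [u [Es bL nb]]]] := HK s 1%:M.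
- by rewrite sK.
- by [].
- by rewrite mulmx1 ltW.
- apply: nb => l; rewrite wmxZ => Hl.
  have b0 : b != [::] by rewrite -size_eq0 -lt0n.
  have := spec_leZ (exprn_gt0 (size b) ts0) (specA b b0).
  move=> /(_ l Hl) H; rewrite (le_trans H) // mulr1 -[leRHS]expr1.
  by rewrite ler_wiXn2l ?(ltW ts0) ?(ltW ts1).
Qed.

End Bounded.

(** * Combinatorics of words *)

Section Seqs.
Variable T : eqType.
Implicit Types (a s u w : seq T).

Lemma flatten_nseqSr m s : flatten (nseq m.+1 s) = flatten (nseq m s) ++ s.
Proof. by elim: m => [|m IH] /=; rewrite ?cats0 // -catA -IH. Qed.

Lemma flatten_nseqD m n s :
  flatten (nseq (m + n) s) = flatten (nseq m s) ++ flatten (nseq n s).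
Proof. by rewrite nseqD flatten_cat. Qed.

Lemma size_flatten_nseq m s : size (flatten (nseq m s)) = (m * size s)%N.
Proof. by elim: m => [|m IH] //=; rewrite size_cat IH. Qed.

Lemma flatten_nseq_rot m s t :
  flatten (nseq m.+1 (t ++ s)) = t ++ flatten (nseq m (s ++ t)) ++ s.
Proof.
elim: m => [|m IH]; first by rewrite /= cats0.
by rewrite -[LHS]/((t ++ s) ++ flatten (nseq m.+1 (t ++ s))) IH /= -!catA.
Qed.

(** If a^n p1 u, with n > 0, were a power of a rotation of a, comparing the first
    letters shows that it would be a power of a. Then p1 u is a power of a too, and
    w1 (p2 p1)^(m+1) u ends with a. *)
Lemma not_power_of_rotation a w1 p1 p2 m u n k m' : a = p1 ++ p2 -> (0 < n)%N ->
  (forall w', w1 ++ flatten (nseq m.+1 (p2 ++ p1)) ++ u <> w' ++ a) ->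
  flatten (nseq n a) ++ p1 ++ u <> flatten (nseq m' (rot k a)).
Proof.
move=> Ea n0 Hw E.
have [a0|a0] := eqVneq a [::].
  by apply: (Hw (w1 ++ flatten (nseq m.+1 (p2 ++ p1)) ++ u)); rewrite a0 cats0.
have sa : (0 < size a)%N by rewrite lt0n size_eq0.
have ss := congr1 size E; rewrite size_cat !size_flatten_nseq size_rot in ss.
case: m' E ss => [|m'] E ss; first by move: ss; rewrite mul0n; nia.
have rota : rot k a = a.
  have := congr1 (take (size a)) E; case: n n0 {E ss} => // n _.
  by rewrite /= -catA take_size_cat // take_size_cat ?size_rot.
rewrite rota in E.
have n_le : (n <= m'.+1)%N by nia.
move: E; rewrite -(subnKC n_le) flatten_nseqD => /eqP.
rewrite eqseq_cat // eqxx /= => /eqP.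
case: (m'.+1 - n)%N => [|j].
  move=> /(congr1 size) /=; rewrite size_cat => /eqP; rewrite addn_eq0 !size_eq0.
  move=> /andP [/eqP p10 /eqP u0]; apply: (Hw (w1 ++ flatten (nseq m (p2 ++ p1)))).
  by rewrite flatten_nseqSr u0 cats0 p10 cats0 Ea p10 /= !catA.
rewrite flatten_nseqSr => Eu.
apply: (Hw (w1 ++ flatten (nseq m (p2 ++ p1)) ++ p2 ++ flatten (nseq j a))).
by rewrite flatten_nseqSr -!catA; do 3 congr (_ ++ _).
Qed.

Lemma max_seq (R : realType) (f : T -> R) x0 s : x0 \in s ->
  exists2 x, x \in s & forall y, y \in s -> f y <= f x.
Proof.
elim: s x0 => // y [|z s] IH x0 _.
  by exists y => [|y']; rewrite inE // => /eqP ->.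
have [x xs Hx] := IH z (mem_head _ _).
have [h|h] := leP (f y) (f x).
  exists x; first by rewrite inE xs orbT.
  by move=> y'; rewrite inE => /orP [/eqP ->//|]; apply: Hx.
exists y; first by rewrite mem_head.
move=> y'; rewrite inE => /orP [/eqP ->//|ys].
by rewrite (le_trans (Hx _ ys)) // ltW.
Qed.

End Seqs.

Lemma words_upto (E : finType) K :
  exists W : seq (seq E), forall s, (size s <= K)%N -> s \in W.
Proof.
elim: K => [|K [W HW]].
  by exists [:: [::]] => s; rewrite leqn0 size_eq0 => /eqP ->.
exists ([::] :: [seq e :: s | e <- enum E, s <- W]) => -[|e s] //= sK.
rewrite inE; apply/orP; right; apply: allpairs_f; first by rewrite mem_enum.
exact: HW.
Qed.

(** * The supremum over all walks is a maximum over finitely many *)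

Section Termination.
Variables (R : realType) (D : nat).

(** [near_return] for a one-letter alphabet: if a large power of S were not small,
    some power of S would have an eigenvalue near 1. *)
Lemma powers_to_zero (S : 'M[R]_D) C q : (forall n, nm (S ^+ n) <= C) ->
  0 <= q -> q < 1 -> spec_le S q ->
  forall e, 0 < e -> exists n0, forall n, (n0 <= n)%N -> nm (S ^+ n) <= e.
Proof.
move=> SC q0 q1 Sq e e0.
have wS (s : seq unit) : wmx (fun=> S) s = S ^+ size s.
  by elim: s => [|x s IH]; rewrite ?wmx_nil ?expr0 // wmx_cons IH exprS.
have [s|K HK] := @near_return R unit D (fun=> S) C D (nm (1%:M : 'M[R]_D)) e q 1 _ e0 q1.
  by rewrite wS.
exists K => n Kn; rewrite leNgt; apply/negP => h.
have [|||s1 [b [u [_ b0 nb]]]] := HK (nseq n tt) 1%:M.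
- by rewrite size_nseq.
- exact: lexx.
- by rewrite mulmx1 wS size_nseq ltW.
apply: nb => l; rewrite wS => /(spec_leX b0 q0 Sq) H.
by rewrite (le_trans H) // -[leRHS]expr1 ler_wiXn2l // ltW.
Qed.

Lemma spec_le_swap (P Q : 'M[R]_D) r : 0 <= r -> spec_le (P *m Q) r -> spec_le (Q *m P) r.
Proof.
move=> r0 H l; have [->|l0] := eqVneq l 0; first by rewrite Normc.normc0.
rewrite map_mxM => /eigenvalueP [x Ex x0].
apply: H; rewrite map_mxM; apply/eigenvalueP.
exists (x *m map_mx (real_complex R) Q).
  by rewrite mulmxA -(mulmxA x) Ex -scalemxAl.
apply: contra x0 => /eqP xQ; move: Ex; rewrite mulmxA xQ mul0mx => /esym /eqP.
by rewrite scaler_eq0 (negPf l0).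
Qed.

Variables (E : finType) (A : E -> 'M[R]_D) (a : seq E).
Variables (phi : 'cV[R]_D) (v : 'rV[R]_D) (sg q q0 : R).
Hypothesis irrA : irreducible_family A.
Hypothesis a_neq0 : a != [::].
Hypothesis sg1 : `|sg| = 1.
Hypothesis va : v *m wmx A a = sg *: v.
Hypothesis aphi : wmx A a *m phi = sg *: phi.
Hypothesis vphi : v *m phi = 1%:M.
Hypothesis q0_ge0 : 0 <= q0.
Hypothesis q0_lt1 : q0 < 1.
Hypothesis q_ge0 : 0 <= q.
Hypothesis q_lt1 : q < 1.
(** The part of the product of a complementary to its leading eigenvalue sg. *)
Let S := wmx A a - sg *: (phi *m v).
Hypothesis specS : spec_le S q0.
Hypothesis speca : spec_le (wmx A a) 1.
Hypothesis spec_other : forall s, s != [::] ->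
  (forall k m, s <> flatten (nseq m (rot k a))) -> spec_le (wmx A s) q.

(** The value at x of the functional phi carried back along the word s. *)
Definition pairing s (x : 'rV[R]_D) : R := (x *m wmx A s *m phi) 0 0.
Local Notation g := pairing.

(** phi v is a projection whose products with S vanish on both sides. *)
Lemma pow_decomp n : wmx A a ^+ n.+1 = sg ^+ n.+1 *: (phi *m v) + S ^+ n.+1.
Proof.
have vS : v *m S = 0.
  by rewrite mulmxBr va -scalemxAr mulmxA vphi mul1mx subrr.
have vSn k : v *m S ^+ k.+1 = 0 by rewrite exprS mulmxA vS mul0mx.
elim: n => [|n IH]; first by rewrite !expr1 /S addrC subrK.
rewrite exprS IH -[in LHS](subrK (sg *: (phi *m v)) (wmx A a)) -/S.
rewrite mulrDl !mulrDr -[in LHS]exprS.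
have -> : (sg *: (phi *m v)) * (S ^+ n.+1) = 0.
  by rewrite -[LHS]/(_ *m _) -scalemxAl -mulmxA vSn mulmx0 scaler0.
have -> : S * (sg ^+ n.+1 *: (phi *m v)) = 0.
  rewrite -[LHS]/(_ *m _) -scalemxAr mulmxA mulmxBl aphi -scalemxAl -mulmxA vphi.
  by rewrite mulmx1 subrr mul0mx scaler0.
rewrite add0r addr0 addrC -[_ * _]/(_ *m _) -scalemxAl -scalemxAr scalerA -exprS.
by rewrite -mulmxA (mulmxA v) vphi mul1mx.
Qed.

Lemma spec_all s : s != [::] -> spec_le (wmx A s) 1.
Proof.
move=> s0; have [[k [m Es]]|H] := pselect (exists k m, s = flatten (nseq m (rot k a))).
  rewrite Es wmx_flatten_nseq.
  have m0 : (0 < m)%N by case: m Es => // Es; rewrite Es in s0.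
  have H : spec_le (wmx A (rot k a)) 1.
    rewrite /rot wmx_cat; apply: spec_le_swap; first exact: ler01.
    by rewrite -wmx_cat cat_take_drop.
  by have := spec_leX m0 ler01 H; rewrite expr1n.
move=> l /(spec_other s0) h; rewrite (le_trans (h _)) ?(ltW q_lt1) //.
by move=> k m Es; apply: H; exists k, m.
Qed.

(** The vectors killed by all functionals form an invariant subspace: the empty word
    has the same functional as a up to sign, so only words with a first letter
    matter. It does not contain v. *)
Lemma pairing_separates x : (forall s, g s x = 0) -> x = 0.
Proof.
pose P x := forall s, g s x = 0.
have [|c y z Py Pz s|y|P0|PT] := irrA (P := P).
- by move=> s; rewrite /g !mul0mx mxE.
- by rewrite /g !mulmxDl mxE [X in _ + X]Pz addr0 -!scalemxAl mxE [X in _ * X]Py mulr0.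
- split=> [Py e s|H s]; first by rewrite /g -(mulmxA y) -wmx_cons; apply: Py.
  have Hc e s' : g (e :: s') y = 0 by rewrite /g wmx_cons mulmxA; apply: H.
  case: s => [|e s]; last exact: Hc.
  case: a a_neq0 aphi => // e s _ Ha; have := Hc e s.
  rewrite /g -mulmxA Ha -scalemxAr mxE wmx_nil mulmx1 => /eqP.
  rewrite mulf_eq0 => /orP [/eqP sg0|/eqP //].
  by move: sg1; rewrite sg0 normr0 => /eqP; rewrite eq_sym oner_eq0.
- exact: P0.
- have := PT v [::]; rewrite /g wmx_nil mulmx1 vphi mxE eqxx => /eqP.
  by rewrite oner_eq0.
Qed.

(** A trailing copy of a changes the functional of a word only by a sign. If a long
    word s does not end with a, then either its functional is small, or by
    [near_return] some factor of s has an eigenvalue of modulus greater than q,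
    hence is a power of a rotation p2 p1 of a. As this factor can be taken long,
    s = w1 p2 a^m p1 u with m large, and a^m is close to sg^m phi v; so the
    functional of s is close to that of w1 p2, up to sign times the factor
    g (p1 u) v. The latter is nearly an eigenvalue of a^n p1 u, which is no power of
    a rotation of a, so its modulus is at most q, up to an error. Hence a long word
    is bounded by q' times the supremum nu, with q' < 1, and nu is attained on
    short words. *)
Lemma finite_maximum : exists W : seq (seq E), forall x s,
  exists2 w, w \in W & `|g s x| <= `|g w x|.
Proof.
have [C0 HC0] := bounded_of_spec irrA spec_all.
pose C := C0 + 1.
have HC s : nm (wmx A s) <= C by rewrite (le_trans (HC0 s)) // lerDl.
have C_gt0 : 0 < C by rewrite ltr_wpDl // (le_trans (nm_ge0 _) (HC0 [::])).
have phi0 : phi != 0.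
  apply/eqP => p0; move: vphi; rewrite p0 mulmx0 => /matrixP /(_ 0 0).
  by rewrite !mxE eqxx => /eqP; rewrite eq_sym oner_eq0.
have nphi := nm_gt0 phi0.
have gC s x : `|g s x| <= nm x * (C * nm phi).
  rewrite (le_trans (nm_entry _ _ _)) // -mulmxA (le_trans (nmM _ _)) //.
  rewrite ler_wpM2l ?nm_ge0 // (le_trans (nmM _ _)) //.
  by rewrite ler_wpM2r ?nm_ge0.
pose nu x := sup [set `|g s x| | s in setT].
have hsup x : has_sup [set `|g s x| | s in setT].
  by split; [exists `|g [::] x|, [::]|exists (nm x * (C * nm phi)) => _ [s _ <-]].
have gnu s x : `|g s x| <= nu x by apply: (ub_le_sup (hsup x).2); exists s.
have nu_le x (M : R) : (forall s, `|g s x| <= M) -> nu x <= M.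
  move=> H; apply: ge_sup; first exact: (hsup x).1.
  by move=> _ [s _ <-].
have gZ s c x : g s (c *: x) = c * g s x by rewrite /g -!scalemxAl mxE.
have gD s x y : g s (x + y) = g s x + g s y by rewrite /g !mulmxDl mxE.
have nu_ge0 x : 0 <= nu x by rewrite (le_trans _ (gnu [::] x)).
have [||//|x nx|c c0 Hc] := @norm_lower R D nu.
- move=> c x; apply/eqP; rewrite eq_le; apply/andP; split.
    by apply: nu_le => s; rewrite gZ normrM ler_wpM2l.
  have [->|c0] := eqVneq c 0; first by rewrite normr0 mul0r.
  rewrite -ler_pdivlMl ?normr_gt0 //; apply: nu_le => s.
  by rewrite ler_pdivlMl ?normr_gt0 // -normrM -gZ.
- move=> x y; apply: nu_le => s; rewrite gD (le_trans (ler_normD _ _)) //.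
  by rewrite lerD.
- by apply: pairing_separates => s; apply/eqP; rewrite -normr_le0 -nx.
(* q' = q + 2 gm: the factor g (p1 u) v and the remainder S ^+ m cost gm each *)
pose gm := (1 - q) / 4; have gm0 : 0 < gm by rewrite divr_gt0 // subr_gt0.
pose q' := (1 + q) / 2.
have q'0 : 0 < q' by rewrite divr_gt0 // ltr_wpDr.
have q'1 : q' < 1 by rewrite /q'; move: q_lt1; lra.
have Slim : forall e, 0 < e -> exists n0, forall n, (n0 <= n)%N -> nm (S ^+ n) <= e.
  apply: (@powers_to_zero S (C + nm (phi *m v) + nm (1%:M : 'M[R]_D)) q0) => //.
  move=> [|n]; first by rewrite expr0 lerDr addr_ge0 ?nm_ge0 // ltW.
  have -> : S ^+ n.+1 = wmx A a ^+ n.+1 - sg ^+ n.+1 *: (phi *m v).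
    by rewrite pow_decomp addrC addKr.
  rewrite (le_trans (nmD _ _)) // -[leLHS]addr0 lerD ?nm_ge0 //.
  rewrite nmN nmZ normrX sg1 expr1n mul1r lerD // -wmx_flatten_nseq.
  exact: HC.
(* g (p1 u) v is up to sign the number by which a^n p1 u nearly multiplies phi *)
have kappa p1 p2 w1 m u : a = p1 ++ p2 ->
    (forall w', w1 ++ flatten (nseq m.+1 (p2 ++ p1)) ++ u <> w' ++ a) ->
    `|g (p1 ++ u) v| <= q + gm.
  move=> Ea Hw.
  have C1 : 0 <= C + nm v * (C * nm phi) by rewrite addr_ge0 ?mulr_ge0 ?nm_ge0 // ltW.
  have [e e0 He] := @near_eigen R D 1 _ _ gm C1 nphi gm0.
  have [n0 Hn] := Slim (e / (C * nm phi)) (divr_gt0 e0 (mulr_gt0 C_gt0 nphi)).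
  pose s := flatten (nseq n0.+1 a) ++ p1 ++ u.
  have -> : `|g (p1 ++ u) v| = `|sg ^+ n0.+1 * g (p1 ++ u) v|.
    by rewrite normrM normrX sg1 expr1n mul1r.
  have s_neq0 : s != [::] by rewrite /s; case: (a) a_neq0.
  have b1 : nm (wmx A s) <= C + nm v * (C * nm phi).
    rewrite (le_trans (HC s)) // lerDl; apply: mulr_ge0; first exact: nm_ge0.
    by rewrite ltW // mulr_gt0.
  have b2 : `|sg ^+ n0.+1 * g (p1 ++ u) v| <= C + nm v * (C * nm phi).
    rewrite normrM normrX sg1 expr1n mul1r (le_trans (gC _ _)) // lerDr.
    exact: ltW.
  have b3 : nm (wmx A s *m phi - (sg ^+ n0.+1 * g (p1 ++ u) v) *: phi) <= e.
    rewrite wmx_cat wmx_flatten_nseq pow_decomp mulmxDl mulmxDl.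
    have -> : sg ^+ n0.+1 *: (phi *m v) *m wmx A (p1 ++ u) *m phi =
              (sg ^+ n0.+1 * g (p1 ++ u) v) *: phi.
      rewrite -!scalemxAl -scalerA; congr (_ *: _).
      rewrite /g -!mulmxA (mulmxA v).
      by rewrite {1}[v *m _ *m _]mx11_scalar mul_mx_scalar.
    rewrite addrAC subrr add0r -mulmxA (le_trans (nmM _ _)) //.
    have h1 : nm (wmx A (p1 ++ u) *m phi) <= C * nm phi.
      by rewrite (le_trans (nmM _ _)) // ler_wpM2r ?nm_ge0.
    have h2 := Hn n0.+1 (leqnSn _).
    apply: (@le_trans _ _ (e / (C * nm phi) * (C * nm phi))).
      by apply: ler_pM => //; apply: nm_ge0.
    by rewrite mulfVK // gt_eqF // mulr_gt0.
  have b4 : spec_le (wmx A s) q.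
    by apply: spec_other => // k m'; apply: (not_power_of_rotation Ea _ Hw).
  exact/ltW/(He (wmx A s) phi _ q b1 b2 (lexx _) b3 b4).
have dl0 : 0 < gm * c / (C * (C * nm phi)).
  by apply: divr_gt0; first exact: mulr_gt0; do 2!apply: mulr_gt0 => //.
have [n1 Hn1] := Slim _ dl0.
have eta0 : 0 < q' * c by rewrite mulr_gt0.
have [K HK] :=
  @near_return R E D A C 1 (nm phi) (q' * c) q (n1.+2 * size a) HC eta0 q_lt1.
have main s x : (K <= size s)%N -> (forall s', s <> s' ++ a) ->
    `|g s x| <= q' * nu x.
  move=> sK sa.
  have [small|big] := leP (nm (wmx A s *m phi)) (q' * c).
    rewrite (le_trans (nm_entry _ _ _)) // -mulmxA (le_trans (nmM _ _)) //.
    apply: (@le_trans _ _ (nm x * (q' * c))); first by rewrite ler_wpM2l ?nm_ge0.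
    by rewrite mulrCA ler_wpM2l ?(ltW q'0) // mulrC.
  have [w1 [b [u [Es bL nb]]]] := HK s phi sK (lexx _) (ltW big).
  have Hb : b != [::] -> exists k m, b = flatten (nseq m (rot k a)).
    move=> b0; apply: contrapT => H; apply: nb; apply: (spec_other b0) => k m Eb.
    apply: H; exists k, m; exact: Eb.
  clear nb.
  have sz0 : (0 < size a)%N by rewrite lt0n size_eq0.
  have b0 : b != [::] by rewrite -size_eq0 -lt0n (leq_trans _ bL) // muln_gt0.
  have [k [m Eb]] := Hb b0.
  have bm : (n1.+2 <= m)%N.
    by move: bL; rewrite Eb size_flatten_nseq size_rot leq_pmul2r.
  case: m Eb bm => // -[|m] Eb; rewrite !ltnS // => n1m.
  pose p1 := take k a; pose p2 := drop k a.
  have Ea : a = p1 ++ p2 by rewrite cat_take_drop.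
  have Hw w' : w1 ++ flatten (nseq m.+2 (p2 ++ p1)) ++ u <> w' ++ a.
    by rewrite -[p2 ++ p1]/(rot k a) -Eb -Es; exact: sa.
  have Hk := kappa p1 p2 w1 m.+1 u Ea Hw.
  have -> : s = (w1 ++ p2) ++ flatten (nseq m.+1 a) ++ (p1 ++ u).
    by rewrite Es Eb -[rot k a]/(p2 ++ p1) flatten_nseq_rot -Ea -!catA.
  set t := w1 ++ p2; set r := p1 ++ u in Hk *.
  have -> : g (t ++ flatten (nseq m.+1 a) ++ r) x =
      sg ^+ m.+1 * (g t x * g r v) +
      (x *m wmx A t *m (S ^+ m.+1 *m (wmx A r *m phi))) 0 0.
    rewrite /g (wmx_cat A t) (wmx_cat A (flatten _)) (wmx_flatten_nseq A m.+1) pow_decomp.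
    rewrite mulmxDl !mulmxDr mulmxDl mxE.
    congr (_ + _); last by rewrite -!mulmxA.
    rewrite -scalemxAl -!scalemxAr -scalemxAl mxE; congr (_ * _).
    have -> : x *m (wmx A t *m (phi *m v *m wmx A r)) *m phi =
              (x *m wmx A t *m phi) *m (v *m wmx A r *m phi) by rewrite !mulmxA.
    by rewrite mxE big_ord1.
  have h1 : `|sg ^+ m.+1 * (g t x * g r v)| <= (q + gm) * nu x.
    rewrite normrM normrX sg1 expr1n mul1r normrM mulrC.
    by apply: ler_pM => //; exact: normr_ge0.
  have h2 : `|(x *m wmx A t *m (S ^+ m.+1 *m (wmx A r *m phi))) 0 0| <= gm * nu x.
    rewrite (le_trans (nm_entry _ _ _)) // -mulmxA (le_trans (nmM _ _)) //.
    apply: (@le_trans _ _ (nm x * (gm * c))); last first.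
      by rewrite mulrCA ler_wpM2l ?(ltW gm0) // mulrC.
    rewrite ler_wpM2l ?nm_ge0 // (le_trans (nmM _ _)) //.
    apply: (@le_trans _ _ (C * (gm * c / (C * (C * nm phi)) * (C * nm phi)))).
      apply: ler_pM => //; rewrite ?nm_ge0 //.
      rewrite (le_trans (nmM _ _)) //; apply: ler_pM; rewrite ?nm_ge0 //.
        by apply: Hn1; rewrite ltnW // ltnS.
      by rewrite (le_trans (nmM _ _)) // ler_wpM2r ?nm_ge0.
    have alg (y z w : R) : 0 < y -> 0 < z -> y * (w / (y * (y * z)) * (y * z)) = w.
      by move=> y0 z0; field; rewrite !gt_eqF.
    by rewrite alg.
  rewrite (le_trans (ler_normD _ _)) // (le_trans (lerD h1 h2)) //.
  rewrite -mulrDl ler_wpM2r //.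
  by rewrite /q' /gm; lra.
pose bnd x (M : R) := forall w, (size w <= K)%N -> `|g w x| <= M.
have all_le x M s : bnd x M -> `|g s x| <= Num.max M (q' * nu x).
  move=> HM; have [n] := ubnP (size s); elim: n s => // n IH s; rewrite ltnS => sn.
  rewrite le_max; have [h|h] := leqP (size s) K; first by rewrite HM.
  have [[s' Es]|H] := pselect (exists s', s = s' ++ a); last first.
    by apply/orP; right; apply: main; [exact: ltnW|move=> s' Es; apply: H; exists s'].
  have -> : `|g s x| = `|g s' x|.
    by rewrite Es /g wmx_cat mulmxA -mulmxA aphi -scalemxAr mxE normrM sg1 mul1r.
  rewrite -le_max; apply: IH; apply: leq_trans sn; rewrite Es size_cat.
  by rewrite -[X in (X < _)%N]addn0 ltn_add2l lt0n size_eq0.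
have [W HW] := words_upto E K.
exists W => x s.
have [w wW Hm] := max_seq (fun w => `|g w x|) (HW [::] isT).
exists w => //; rewrite (le_trans (gnu s x)) //.
have nux : nu x <= Num.max `|g w x| (q' * nu x).
  by apply: nu_le => s'; apply: all_le => w' w'K; apply: Hm; apply: HW.
move: nux; rewrite le_max => /orP [//|h].
have : nu x <= 0.
  have : (1 - q') * nu x <= 0 by rewrite mulrBl mul1r subr_le0.
  by rewrite pmulr_rle0 // subr_gt0.
by move=> h2; rewrite (le_trans h2).
Qed.

End Termination.

(** * Bounded intersections of half-spaces are polytopes *)

Section Polytope.
Variables (R : realType) (V : vectType R).
Implicit Types (s : seq V) (x y : V).

Definition lin_form (g : V -> R) :=
  (forall c x, g (c *: x) = c * g x) /\ (forall x y, g (x + y) = g x + g y).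

Lemma lin_form_sum g (I : Type) (r : seq I) (P : pred I) (c : I -> R) (p : I -> V) :
  lin_form g -> g (\sum_(i <- r | P i) c i *: p i) = \sum_(i <- r | P i) c i * g (p i).
Proof.
move=> [gZ gD]; apply: (big_ind2 (fun u t => g u = t)) => [|u t u' t' <- <-|i _].
- by rewrite -(scale0r 0) gZ mul0r.
- exact: gD.
- exact: gZ.
Qed.

(** Zero weights are allowed at points outside s; moving those points to one with
    nonzero weight turns the family into a combination of entries of s. *)
Lemma hull_comb s (I : finType) (c : I -> R) (p : I -> V) :
  (forall i, 0 <= c i) -> \sum_i c i = 1 -> (forall i, c i != 0 -> p i \in s) ->
  convex_hull s (\sum_i c i *: p i).
Proof.
move=> c0 c1 ps.
have [i0 ci0] : exists i, c i != 0.
  apply: contrapT => H; move: c1; rewrite big1 => [/eqP|i _].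
    by rewrite eq_sym oner_eq0.
  by apply/eqP; apply: contrapT => /negP ci; apply: H; exists i.
pose p' i := if c i == 0 then p i0 else p i.
have p's i : p' i \in s by rewrite /p'; case: eqP => // /eqP; auto.
pose k i : 'I_(size s) := Ordinal (etrans (index_mem (p' i) s) (p's i)).
exists (fun j => \sum_(i | k i == j) c i); split.
- by move=> j; apply: sumr_ge0.
- by rewrite -c1 [RHS](partition_big k predT).
- rewrite [LHS](partition_big k predT) //=; apply: eq_bigr => j _.
  rewrite scaler_suml; apply: eq_bigr => i /eqP <- /=.
  rewrite nth_index // /p'; case: eqP => // ->; by rewrite !scale0r.
Qed.

Lemma hull_trans s t x : (forall y, y \in t -> convex_hull s y) ->
  convex_hull t x -> convex_hull s x.
Proof.
move=> H [c [c0 c1 ->]].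
have /choice [d Hd] : forall k : 'I_(size t), exists d : 'I_(size s) -> R,
   [/\ forall j, 0 <= d j, \sum_j d j = 1 & t`_k = \sum_j d j *: s`_j].
  by move=> k; apply: H; apply: mem_nth.
have -> : \sum_k c k *: t`_k =
    \sum_(kj : 'I_(size t) * 'I_(size s)) (c kj.1 * d kj.1 kj.2) *: s`_kj.2.
  rewrite -(pair_bigA _ (fun k j => (c k * d k j) *: s`_j)) /=.
  apply: eq_bigr => k _; have [_ _ ->] := Hd k; rewrite scaler_sumr.
  by apply: eq_bigr => j _; rewrite scalerA.
apply: hull_comb.
- by move=> [k j] /=; rewrite mulr_ge0 //; have [] := Hd k.
- rewrite -(pair_bigA _ (fun k j => c k * d k j)) /= -c1.
  by apply: eq_bigr => k _; rewrite -mulr_sumr; have [_ -> _] := Hd k; rewrite mulr1.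
- by move=> [k j] _ /=; apply: mem_nth.
Qed.

Lemma hull_mem s x : x \in s -> convex_hull s x.
Proof.
move=> xs; rewrite (_ : x = \sum_(i : unit) (1 : R) *: x); last first.
  by rewrite big_const cardE /= enumT unlock /= addr0 scale1r.
by apply: hull_comb => //; rewrite big_const cardE /= enumT unlock /= addr0.
Qed.

(** The point of the segment from x to y where g equals 1. *)
Definition crossing (g : V -> R) x y : V :=
  (g y - g x)^-1 *: ((g y - 1) *: x + (1 - g x) *: y).

(** The generators of the part of a hull lying in the half-space g <= 1. *)
Definition cut (g : V -> R) s : seq V :=
  [seq x <- s | g x <= 1] ++
  [seq crossing g x y | x <- [seq x <- s | g x <= 1], y <- [seq y <- s | 1 < g y]].

(** For the nontrivial inclusion let x be a combination with weights c of entries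
    of s, let M and P be the total weighted distances of the low entries (g <= 1)
    and of the high ones to the hyperplane g = 1, so that P <= M. Replace each high
    entry by its crossing points with all low ones: the pair (k, l) gets weight
    c k * c l * (g l - g k) / M, and the low entry k keeps c k * (1 - P / M). *)
Lemma cutP g s x : lin_form g ->
  convex_hull (cut g s) x <-> convex_hull s x /\ g x <= 1.
Proof.
move=> gl; have [gZ gD] := gl; split.
  have cr y z : g y <= 1 -> 1 < g z -> g (crossing g y z) = 1.
    move=> y1 z1; rewrite /crossing gZ gD !gZ.
    have d0 : g z - g y != 0 by rewrite gt_eqF // subr_gt0 (le_lt_trans y1).
    apply: (mulfI d0); rewrite mulVKf // mulr1; ring.
  have gcut y : y \in cut g s -> g y <= 1.
    rewrite mem_cat mem_filter => /orP [/andP [] //|/allpairsP [[y1 y2] /=]].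
    by rewrite !mem_filter => -[/andP [h1 _] /andP [h2 _] ->]; rewrite cr.
  move=> Hx; split.
    apply: hull_trans Hx => y; rewrite mem_cat mem_filter => /orP [/andP [_]|].
      exact: hull_mem.
    move=> /allpairsP [[y1 y2] /=]; rewrite !mem_filter.
    move=> -[/andP [h1 s1] /andP [h2 s2] ->].
    have d0 : 0 < g y2 - g y1 by rewrite subr_gt0 (le_lt_trans h1).
    rewrite /crossing scalerDr !scalerA.
    rewrite (_ : _ + _ = \sum_(b : bool)
       (if b then (g y2 - g y1)^-1 * (g y2 - 1) else (g y2 - g y1)^-1 * (1 - g y1)) *:
       (if b then y1 else y2)); last by rewrite big_bool.
    apply: hull_comb.
    - by case; rewrite mulr_ge0 ?invr_ge0 ?(ltW d0) // subr_ge0 // ltW.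
    - rewrite big_bool /= -mulrDr addrA subrK mulVf // gt_eqF //.
    - by case.
  have [c [c0 c1 ->]] := Hx; rewrite lin_form_sum // -c1.
  apply: ler_sum => k _; rewrite ler_piMr //.
  by apply: gcut; apply: mem_nth.
move=> [[c [c0 c1 Ex]] gx1].
pose n := size s; pose low (k : 'I_n) := g s`_k <= 1.
pose M := \sum_(k | low k) c k * (1 - g s`_k).
pose P := \sum_(k | ~~ low k) c k * (g s`_k - 1).
have tM k : low k -> 0 <= c k * (1 - g s`_k) by move=> lk; rewrite mulr_ge0 // subr_ge0.
have tP k : ~~ low k -> 0 <= c k * (g s`_k - 1).
  by rewrite -ltNge => lk; rewrite mulr_ge0 // subr_ge0 ltW.
have M0 : 0 <= M by apply: sumr_ge0.
have P0 : 0 <= P by apply: sumr_ge0.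
have PM : P <= M.
  rewrite -subr_ge0 (_ : M - P = \sum_k c k * (1 - g s`_k)).
    under eq_bigr do rewrite mulrBr mulr1.
    by rewrite sumrB c1 -lin_form_sum // -Ex subr_ge0.
  rewrite [RHS](bigID low) /=; congr (_ + _); rewrite /P -sumrN.
  by apply: eq_bigr => k _; rewrite -mulrN opprB.
(* if M = 0, then P = 0 and the high entries have weight zero *)
have MM l : ~~ low l -> c l != 0 -> M / M = 1.
  move=> ll cl; rewrite divff // gt_eqF //; apply: lt_le_trans PM.
  apply: (@lt_le_trans _ _ (c l * (g s`_l - 1))).
    by apply: mulr_gt0; [rewrite lt0r cl c0|rewrite subr_gt0 ltNge].
  by rewrite /P (bigD1 l) //= lerDl; apply: sumr_ge0 => k /andP [lk _]; apply: tP.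
pose w (i : 'I_n + 'I_n * 'I_n) : R := match i with
  | inl k => if low k then c k * (1 - P / M) else 0
  | inr kl => if low kl.1 && ~~ low kl.2 then
       c kl.1 * c kl.2 * (g s`_kl.2 - g s`_kl.1) / M else 0 end.
pose p (i : 'I_n + 'I_n * 'I_n) : V := match i with
  | inl k => s`_k
  | inr kl => crossing g s`_kl.1 s`_kl.2 end.
have key (W : lmodType R) (u : 'I_n -> W) :
    \sum_(k | low k) (c k * (1 - P / M)) *: u k +
    \sum_(k | low k) \sum_(l | ~~ low l)
       (c k * c l / M) *: ((g s`_l - 1) *: u k + (1 - g s`_k) *: u l)
    = \sum_k c k *: u k.
  under [X in _ + X]eq_bigr => k lk.
    under eq_bigr do rewrite scalerDr !scalerA.
    rewrite big_split /= -scaler_suml; over.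
  rewrite big_split /= addrA -big_split /= [RHS](bigID low) /=.
  congr (_ + _).
    apply: eq_bigr => k lk; rewrite -scalerDl; congr (_ *: _).
    have -> : \sum_(l | ~~ low l) c k * c l / M * (g s`_l - 1) = c k * (P / M).
      by rewrite /P mulr_suml mulr_sumr; apply: eq_bigr => l _; ring.
    by rewrite -mulrDr subrK mulr1.
  rewrite exchange_big /=; apply: eq_bigr => l ll; rewrite -scaler_suml.
  congr (_ *: _).
  have [->|cl] := eqVneq (c l) 0.
    by rewrite big1 // => k _; rewrite mulr0 !mul0r.
  transitivity (c l * (M / M)); last by rewrite (MM l) ?mulr1.
  rewrite {2}/M mulr_suml mulr_sumr.
  by apply: eq_bigr => k _; ring.
(* used for the points themselves and for the constant family 1 *)
have wE (W : lmodType R) (u : 'I_n -> W) (uu : 'I_n -> 'I_n -> W) :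
    (forall k l, low k -> ~~ low l ->
      (g s`_l - g s`_k) *: uu k l = (g s`_l - 1) *: u k + (1 - g s`_k) *: u l) ->
    \sum_i w i *: (match i with inl k => u k | inr kl => uu kl.1 kl.2 end)
    = \sum_k c k *: u k.
  move=> Huu; rewrite -key big_sumType /=; congr (_ + _).
    rewrite [RHS]big_mkcond; apply: eq_bigr => k _.
    by case: ifP => //; rewrite scale0r.
  rewrite [RHS]big_mkcond /=.
  rewrite -(pair_bigA _ (fun k l => w (inr (k, l)) *: uu k l)) /=.
  apply: eq_bigr => k _; case: ifP => lk /=; last first.
    by rewrite big1 // => l _; rewrite scale0r.
  rewrite [RHS]big_mkcond /=; apply: eq_bigr => l _.
  case: ifP => ll; last by rewrite scale0r.
  by rewrite -Huu // scalerA mulrAC.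
have -> : x = \sum_i w i *: p i.
  rewrite Ex -(wE _ (fun k => s`_k) (fun k l => crossing g s`_k s`_l)).
    by apply: eq_bigr => -[k|[k l]].
  move=> k l lk ll; rewrite /crossing scalerA mulfV ?scale1r //.
  by rewrite gt_eqF // subr_gt0 (le_lt_trans lk) // ltNge.
apply: hull_comb.
- case=> [k|[k l]] /=.
    case: ifP => // lk; rewrite mulr_ge0 // subr_ge0.
    have [->|Mn0] := eqVneq M 0; first by rewrite invr0 mulr0.
    by rewrite ler_pdivrMr ?mul1r // lt0r Mn0.
  case: ifP => // /andP [lk ll]; rewrite divr_ge0 // mulr_ge0 ?mulr_ge0 //.
  by rewrite subr_ge0 ltW // (le_lt_trans lk) // ltNge.
- have := wE R^o (fun=> 1) (fun _ _ => 1).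
  rewrite (_ : \sum_k c k *: 1 = 1); last first.
    by rewrite -[RHS]c1; apply: eq_bigr => k _; rewrite -[LHS]/(_ * _) mulr1.
  move=> <-; first by apply: eq_bigr => -[k|[k l]] _; rewrite -[RHS]/(_ * _) mulr1.
  by move=> k l _ _; rewrite -[LHS]/(_ * _) -[RHS]/(_ * _ + _ * _) !mulr1 addrA subrK.
- case=> [k|[k l]] /=; case: ifP; rewrite ?eqxx // => H _; rewrite /cut mem_cat.
    by rewrite mem_filter -/(low k) H mem_nth.
  apply/orP; right; move: H => /andP [lk ll].
  by apply: allpairs_f; rewrite mem_filter mem_nth // andbT // ltNge.
Qed.

(** The set lies in a large cross-polytope; intersect the latter with the
    half-spaces one after another. *)
Lemma polytope_of_bounded n (g : nat -> V -> R) (C : R) :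
  (forall k, (k < n)%N -> lin_form (g k)) ->
  (forall x, (forall k, (k < n)%N -> g k x <= 1) ->
     \sum_i `|coord (vbasis {: V}) i x| <= C) ->
  is_polytope [set x | forall k, (k < n)%N -> g k x <= 1].
Proof.
move=> gl HC.
pose e i := (vbasis {: V})`_i; pose d := \dim {: V}.
pose C' := `|C| + 1; have C'0 : 0 < C' by rewrite ltr_wpDl.
(* the origin takes the weight missing in the coordinates *)
pose s0 : seq V := 0 :: [seq C' *: y | y <- vbasis {: V}] ++
                       [seq - C' *: y | y <- vbasis {: V}].
have [s Hs] : exists s, forall x, convex_hull s x <->
    convex_hull s0 x /\ forall k, (k < n)%N -> g k x <= 1.
  elim: n gl {HC} => [|n IH] gl.
    by exists s0 => x; split=> [|[]].
  have [k kn|s Hs] := IH; first by apply: gl; rewrite ltnW.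
  exists (cut (g n) s) => x; rewrite cutP; last exact: gl.
  rewrite Hs; split=> [[[h0 h1] h2]|[h0 h1]].
    by split=> // k; rewrite ltnS leq_eqVlt => /orP [/eqP ->|/h1].
  by split; [split=> // k kn; apply: h1; rewrite ltnW|exact: h1].
exists s; apply/seteqP; split=> x /=; last by move=> /Hs [].
move=> Hx; apply/Hs; split=> //.
have := HC x Hx.
pose a i := coord (vbasis {: V}) i x => Ha.
have sumC : \sum_i `|a i| <= C'.
  by rewrite (le_trans Ha) // (le_trans (ler_norm C)) // lerDl.
pose w (o : option 'I_d) := if o is Some i then `|a i| / C' else 1 - (\sum_i `|a i|) / C'.
pose p (o : option 'I_d) := if o is Some i then (Num.sg (a i) * C') *: e i else 0.
have bigo (W : nmodType) (F : option 'I_d -> W) : \sum_o F o = F None + \sum_i F (Some i).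
  rewrite (bigD1 None) //= (reindex_omap Some id) //=; last by case.
  by congr (_ + _); apply: eq_bigl => i; rewrite eqxx.
have -> : x = \sum_o w o *: p o.
  rewrite bigo /= scaler0 add0r [LHS](coord_vbasis (memvf x)).
  apply: eq_bigr => i _; rewrite scalerA; congr (_ *: _).
  by rewrite mulrCA mulfVK ?gt_eqF // -[a i]/(coord _ i x) -numEsg.
apply: hull_comb.
- case=> [i|] /=; first by rewrite divr_ge0 // ltW.
  by rewrite subr_ge0 ler_pdivrMr // mul1r.
- by rewrite bigo /= -mulr_suml subrK.
- case=> [i|] _ /=; last by rewrite inE eqxx.
  have ei : e i \in (vbasis {: V} : seq V) by rewrite mem_nth // size_tuple.
  rewrite inE mem_cat; case: sgrP => _.
  + by rewrite mul0r scale0r eqxx.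
  + by rewrite mul1r map_f // orbT.
  + by rewrite mulN1r [X in _ || (_ || X)]map_f ?orbT.
Qed.

End Polytope.

(** * The joint spectral radius of a triplet with a Barabanov multinorm *)

Section NormEquivalence.
Variables (R : realType).

Lemma norm_equiv (V : vectType R) (N N' : V -> R) : is_norm N -> is_norm N' ->
  exists2 C, 0 < C & forall x, N x <= C * N' x.
Proof.
move=> [N0 Ne NZ ND] [N'0 N'e N'Z N'D].
have bV := vbasisP {: V}.
set b := vbasis {: V} in bV.
have [||C HC] := @norm_upper R _ (fun u => N (vecof b u)).
- by move=> a u; rewrite linearZ NZ.
- by move=> u w; rewrite linearD ND.
have [||||c c0 Hc] := @norm_lower R _ (fun u => N' (vecof b u)).
- by move=> a u; rewrite linearZ N'Z.
- by move=> u w; rewrite linearD N'D.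
- by [].
- by move=> u /N'e /eqP; rewrite vecof_eq0 // => /eqP.
exists ((`|C| + 1) / c); first by rewrite divr_gt0 // ltr_wpDl.
move=> x; have := HC (rVof b x); have := Hc (rVof b x); rewrite rVofK // => h1 h2.
rewrite (le_trans h2) //; apply: (@le_trans _ _ ((`|C| + 1) * nm (rVof b x))).
  by rewrite ler_wpM2r ?nm_ge0 // (le_trans (ler_norm C)) // lerDl.
rewrite -mulrA ler_wpM2l ?addr_ge0 // mulrC ler_pdivlMr // mulrC //.
Qed.

Lemma root_cvg1 (K : R) : 0 < K -> (fun k : nat => K `^ (k%:R^-1)) @ \oo --> (1 : R).
Proof.
move=> K0; rewrite -cvg_shiftS /=.
have -> : (fun n : nat => K `^ (n.+1%:R^-1)) = expR \o (fun n => ln K * harmonic n).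
  by apply/funext => n /=; rewrite /powR gt_eqF // mulrC.
rewrite -expR0; apply: continuous_cvg; first exact: continuous_expR.
by rewrite -(mulr0 (ln K)); apply: cvgMr; exact: cvg_harmonic.
Qed.

End NormEquivalence.

Section JSR.
Variables (R : realType) (G : multigraph) (xi : triplet R G).

Lemma is_norm_pos (V : vectType R) (N : V -> R) x : is_norm N -> x != 0 -> 0 < N x.
Proof.
by move=> [N0 Ne _ _] x0; rewrite lt0r N0 andbT; apply: contra x0 => /eqP /Ne ->.
Qed.

Lemma exists_unit (V : vectType R) (N : V -> R) : (0 < \dim {: V})%N -> is_norm N ->
  exists x, N x = 1.
Proof.
move=> V0 NN; have [N0 Ne NZ ND] := NN.
have x0 : vpick {: V} != 0 by rewrite vpick0 -dimv_eq0 -lt0n.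
exists ((N (vpick {: V}))^-1 *: vpick {: V}).
have n0 := is_norm_pos NN x0.
by rewrite NZ gtr0_norm ?invr_gt0 // mulVf // gt_eqF.
Qed.

Lemma multinorm_equiv (nu mu : forall i, lspace xi i -> R) :
  is_multinorm xi nu -> is_multinorm xi mu ->
  exists2 C, 0 < C & forall i x, nu i x <= C * mu i x.
Proof.
move=> hnu hmu.
have [C HC] := choice (fun i => (let: ex_intro2 C C0 H := norm_equiv (hnu i) (hmu i) in
  ex_intro (fun C => 0 < C /\ forall x, nu i x <= C * mu i x) C (conj C0 H))).
exists (1 + \sum_i C i).
  by rewrite ltr_wpDr // sumr_ge0 // => i _; rewrite ltW //; case: (HC i).
move=> i x; rewrite (le_trans ((HC i).2 x)) // ler_wpM2r //; first by case: (hmu i).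
rewrite (bigD1 i) //= addrCA lerDl addr_ge0 // sumr_ge0 // => j _.
by rewrite ltW //; case: (HC j).
Qed.

Variables (nu : forall i, lspace xi i -> R) (lam : R).
Hypothesis nuN : is_multinorm xi nu.
Hypothesis lam0 : 0 < lam.
Hypothesis nuB : forall i (x : lspace xi i),
  \big[Num.max/0]_(j < nvert G) \big[Num.max/0]_(e : edge i j) nu (op xi e x)
    = lam * nu x.

Lemma growth_le i j (w : walk i j) (x : lspace xi i) :
  nu (wprod xi w x) <= lam ^+ walk_length w * nu x.
Proof.
rewrite /walk_length; elim: w => [|j' k w IH e] /=.
  by rewrite id_lfunE expr0 mul1r.
rewrite size_rcons comp_lfunE exprS -mulrA.
apply: (@le_trans _ _ (lam * nu (wprod xi w x))); last by rewrite ler_pM2l.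
rewrite -nuB; apply: le_trans (le_bigmax _ _ k).
by apply: le_trans (le_bigmax _ _ e).
Qed.

(** Follow at each vertex an edge realizing the maximum. *)
Lemma growth_eq i (x : lspace xi i) k : x != 0 -> exists j (w : walk i j),
  walk_length w = k /\ nu (wprod xi w x) = lam ^+ k * nu x.
Proof.
move=> x0; elim: k => [|k [j [w [wk Hw]]]].
  by exists i, (walk_nil i); split=> //=; rewrite id_lfunE expr0 mul1r.
have pos : 0 < lam ^+ k.+1 * nu x by rewrite mulr_gt0 ?exprn_gt0 // is_norm_pos.
have := nuB (wprod xi w x); rewrite Hw mulrA -exprS => Hm.
have : lam ^+ k.+1 * nu x <= \big[Num.max/0]_(j' < nvert G)
   \big[Num.max/0]_(e : edge j j') nu (op xi e (wprod xi w x)) by rewrite Hm.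
case/bigmax_geP => [|[j' _]]; first by rewrite leNgt pos.
case/bigmax_geP => [|[e _ He]]; first by rewrite leNgt pos.
exists j', (walk_rcons w e); split; first by rewrite /walk_length /= size_rcons -wk.
apply/eqP; rewrite eq_le; apply/andP; split; last by rewrite comp_lfunE.
apply: le_trans (growth_le _ _) _.
by rewrite /walk_length /= size_rcons -/(walk_length w) wk.
Qed.

(** In the multinorm nu the largest norm of a product of length k is lam ^+ k; in mu
    it differs by at most the factor K from it, and the k-th root of K tends to 1. *)
Lemma max_growth_cvg (mu : forall i, lspace xi i -> R) : (0 < nvert G)%N ->
  is_multinorm xi mu -> max_growth xi mu @ \oo --> lam.
Proof.
move=> n0 muN.
have [C C0 HC] := multinorm_equiv muN nuN.
have [C' C'0 HC'] := multinorm_equiv nuN muN.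
pose K := C * C'; have K0 : 0 < K by rewrite mulr_gt0.
have mu_ge0 i x : 0 <= mu i x by case: (muN i).
have opsup i j (w : walk i j) x : mu i x = 1 ->
    mu j (wprod xi w x) <= K * lam ^+ walk_length w.
  move=> mx; rewrite (le_trans (HC _ _)) // -mulrA ler_pM2l //.
  rewrite (le_trans (growth_le _ _)) // mulrC ler_pM2r ?exprn_gt0 //.
  by rewrite (le_trans (HC' _ _)) // mx mulr1.
have nonempty i j (w : walk i j) :
    [set mu j (wprod xi w x) | x in [set x | mu i x = 1]] !=set0.
  have [x mx] := exists_unit (lspace_dim_gt0 xi i) (muN i).
  by exists (mu j (wprod xi w x)), x.
have op_le i j (w : walk i j) :
    op_norm (@mu i) (@mu j) (wprod xi w) <= K * lam ^+ walk_length w.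
  by apply: ge_sup => // _ [x mx <-]; apply: opsup.
have op_ge i j (w : walk i j) x : mu i x = 1 ->
    mu j (wprod xi w x) <= op_norm (@mu i) (@mu j) (wprod xi w).
  move=> mx; apply: ub_le_sup; last by exists x.
  by exists (K * lam ^+ walk_length w) => _ [y my <-]; apply: opsup.
have op_ge0 i j (w : walk i j) : 0 <= op_norm (@mu i) (@mu j) (wprod xi w).
  have [x mx] := exists_unit (lspace_dim_gt0 xi i) (muN i).
  by apply: le_trans (op_ge _ _ w x mx).
have root_lam (c : R) k : 0 < c -> (0 < k)%N ->
    (c * lam ^+ k) `^ (k%:R^-1) = c `^ (k%:R^-1) * lam.
  move=> c0 k0; rewrite powRM ?exprn_ge0 ?ltW //; congr (_ * _).
  rewrite -powR_mulrn ?(ltW lam0) // -powRrM mulfV ?powRr1 ?(ltW lam0) //.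
  by rewrite pnatr_eq0 -lt0n.
have near_bnd : \forall k \near \oo,
    K^-1 `^ (k%:R^-1) * lam <= max_growth xi mu k <= K `^ (k%:R^-1) * lam.
  near=> k; have k0 : (0 < k)%N by near: k; exists 1%N.
  have k1 : 0 <= (k%:R : R)^-1 by rewrite invr_ge0.
  have KL (c : R) : 0 < c -> 0 <= c * lam ^+ k.
    by move=> c0; rewrite mulr_ge0 ?exprn_ge0 ?(ltW lam0) ?(ltW c0).
  have bnd r : (exists i j (w : walk i j), walk_length w = k /\
      r = op_norm (@mu i) (@mu j) (wprod xi w) `^ (k%:R^-1)) -> r <= K `^ (k%:R^-1) * lam.
    move=> [i [j [w [wk ->]]]]; rewrite -root_lam //.
    apply: ge0_ler_powR => //; rewrite ?nnegrE ?KL //.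
    by rewrite -wk.
  pose i0 : 'I_(nvert G) := Ordinal n0.
  have [x mx] := exists_unit (lspace_dim_gt0 xi i0) (muN i0).
  have x0 : x != 0.
    apply/eqP => x0; have [_ _ muZ _] := muN i0; move: mx.
    by rewrite x0 -(scale0r 0) muZ normr0 mul0r => /eqP; rewrite eq_sym oner_eq0.
  have [j [w [wk Hw]]] := growth_eq k x0.
  apply/andP; split.
    rewrite -root_lam ?invr_gt0 //.
    apply: (@le_trans _ _ (op_norm (@mu i0) (@mu j) (wprod xi w) `^ (k%:R^-1))).
      apply: ge0_ler_powR => //; rewrite ?nnegrE ?KL ?invr_gt0 //.
      rewrite (le_trans _ (op_ge _ _ w x mx)) // mulrC ler_pdivrMr //.
      have h1 : lam ^+ k <= C * nu (wprod xi w x).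
        by rewrite Hw mulrCA -[leLHS]mulr1 ler_pM2l ?exprn_gt0 // -mx.
      by rewrite (le_trans h1) // /K mulrCA ler_pM2l // mulrC.
    apply: ub_le_sup; last by exists i0, j, w.
    by exists (K `^ (k%:R^-1) * lam) => r; apply: bnd.
  apply: ge_sup; last by move=> r; apply: bnd.
  by exists (op_norm (@mu i0) (@mu j) (wprod xi w) `^ (k%:R^-1)), i0, j, w.
apply: (squeeze_cvgr near_bnd).
- rewrite -[X in _ --> X]mul1r; apply: cvgMl; apply: root_cvg1.
  by rewrite invr_gt0.
- by rewrite -[X in _ --> X]mul1r; apply: cvgMl; apply: root_cvg1.
Unshelve. all: by end_near.
Qed.

Lemma jsr_of_barabanov : (0 < nvert G)%N -> joint_spectral_radius xi = lam.
Proof.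
move=> n0; rewrite /joint_spectral_radius.
set S := [set r | _].
have Slam : S lam by move=> mu muN; exact: max_growth_cvg.
have /(_ nu nuN) h := getPex (ex_intro S lam Slam).
exact: (cvg_unique _ h (max_growth_cvg n0 nuN)).
Qed.

End JSR.

(** * Simple eigenvalues *)

Section SimpleEigenvalue.

(** Multiply X - M on the left by an invertible matrix whose first r rows span the
    eigenspace: these rows become multiples of X - l. *)
Lemma geometric_le_algebraic (F : fieldType) n (M : 'M[F]_n) l :
  (\rank (eigenspace M l) <= mup l (char_poly M))%N.
Proof.
set Es := eigenspace M l; set r := \rank Es.
have pne : char_poly M != 0 by rewrite monic_neq0 // char_poly_monic.
rewrite mup_geq //.
pose B := row_ebase Es; pose Bp := map_mx polyC B.
pose Id : 'M[{poly F}]_n := pid_mx r; pose Co : 'M[{poly F}]_n := copid_mx r.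
pose cM := char_poly_mx M.
have rn : (r <= n)%N by exact: rank_leq_row.
pose pid : 'M[F]_n := pid_mx r.
have pidB : pid *m B *m M = l *: (pid *m B).
  apply/eigenspaceP; rewrite -[X in (_ <= X)%MS](mulmx_ebase Es) -/r -/B -mulmxA.
  by rewrite -{1}[pid *m B](mulKmx (col_ebase_unit Es)) submxMl.
have E1 : Id *m Bp *m cM = ('X - l%:P) *: (Id *m Bp).
  rewrite /cM /char_poly_mx mulmxBr mul_mx_scalar scalerBl; congr (_ - _).
  have -> : Id = map_mx polyC pid by rewrite map_pid_mx.
  by rewrite -!map_mxM pidB map_mxZ.
have IdId : Id *m Id = Id by rewrite /Id pid_mx_id.
have IdCo : Id *m Co = 0 by rewrite /Co /copid_mx mulmxBr mulmx1 IdId subrr.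
have CoId : Co *m Id = 0 by rewrite /Co /copid_mx mulmxBl mul1mx IdId subrr.
have CoCo : Co *m Co = Co.
  by rewrite {1}/Co /copid_mx mulmxBl mul1mx IdCo subr0.
pose Dg : 'M[{poly F}]_n := ('X - l%:P) *: Id + Co.
have DgId : Dg *m Id = ('X - l%:P) *: Id by rewrite mulmxDl -scalemxAl IdId CoId addr0.
have DgCo : Dg *m Co = Co by rewrite mulmxDl -scalemxAl IdCo CoCo scaler0 add0r.
have E2 : Bp *m cM = Dg *m (Id *m Bp + Co *m Bp *m cM).
  rewrite mulmxDr mulmxA DgId -mulmxA mulmxA DgCo -scalemxAl -E1 -mulmxA -mulmxDl.
  by rewrite /Co /copid_mx addrC subrK mul1mx.
have DgE : Dg = diag_mx (\row_(i < n) if (i < r)%N then 'X - l%:P else 1).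
  apply/matrixP => i j; rewrite /Dg /Co /copid_mx !mxE.
  rewrite -!val_eqE /=; have [_|_] := eqVneq (i : nat) (j : nat) => /=.
    by case: ltnP => _; rewrite !mulr1n /= ?mulr1 ?subrr ?addr0 // mulr0 subr0 add0r.
  by rewrite !mulr0n mulr0 subr0 addr0.
have detDg : \det Dg = ('X - l%:P) ^+ r.
  rewrite DgE det_diag.
  rewrite (eq_bigr (fun i : 'I_n => if (i < r)%N then 'X - l%:P else 1)); last first.
    by move=> i _; rewrite mxE.
  by rewrite -big_mkcond -(big_ord_widen n (fun=> 'X - l%:P) rn) prodr_const card_ord.
have : \det (Bp *m cM) = \det Dg * \det (Id *m Bp + Co *m Bp *m cM).
  by rewrite E2 det_mulmx.
rewrite det_mulmx detDg det_map_mx -/(char_poly M) => E3.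
have Bu : \det B != 0 by have := row_ebase_unit Es; rewrite unitmxE unitfE.
rewrite -(dvdpZr _ _ Bu) -mul_polyC E3; exact: dvdp_mulr.
Qed.

Lemma eigenvector_unique (F : fieldType) n (M : 'M[F]_n) l (v x : 'rV_n) :
  mup l (char_poly M) = 1%N -> v != 0 -> v *m M = l *: v -> x *m M = l *: x ->
  exists c, x = c *: v.
Proof.
move=> m1 v0 vM xM.
have r1 : (\rank (eigenspace M l) <= 1)%N by rewrite -m1 geometric_le_algebraic.
have vE : (v <= eigenspace M l)%MS by apply/eigenspaceP.
have xE : (x <= eigenspace M l)%MS by apply/eigenspaceP.
have Ev : (eigenspace M l <= v)%MS.
  by rewrite -(mxrank_leqif_sup vE) eqn_leq mxrankS //= rank_rV v0.
have /submxP [c Hc] := submx_trans xE Ev.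
by exists (c 0 0); rewrite Hc {1}[c]mx11_scalar mul_scalar_mx.
Qed.

(** Write the characteristic polynomial as q (X - l) with q(l) nonzero. By
    Cayley-Hamilton the rows of q(M) are left eigenvectors, hence multiples of v, and
    its columns are right eigenvectors: q(M) = phi0 v. It acts on v as q(l), so
    v phi0 = q(l). *)
Lemma simple_eigen (F : fieldType) n (M : 'M[F]_n) l :
  eigenvalue M l -> mup l (char_poly M) = 1%N ->
  exists (v : 'rV_n) (phi : 'cV_n),
    [/\ v *m M = l *: v, M *m phi = l *: phi & v *m phi = 1%:M].
Proof.
case: n M => [|n] M.
  by move=> /eigenvalueP [v _ /eqP []]; apply/rowP => -[].
move=> /eigenvalueP [v vM v0] m1.
have rl : root (char_poly M) l.
  by rewrite -eigenvalue_root_char; apply/eigenvalueP; exists v.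
have [q Eq] := factor_theorem _ _ rl.
have pne : char_poly M != 0 by rewrite monic_neq0 // char_poly_monic.
have qne : q != 0 by apply: contra pne => /eqP q0; rewrite Eq q0 mul0r.
have ql : ~~ root q l.
  rewrite -dvdp_XsubCl XsubC_dvd // -leqNgt leqn0.
  move: m1; rewrite Eq mupM ?polyXsubC_eq0 // -['X - _]expr1 mup_XsubCX eqxx addn1.
  by move=> [->].
pose T := horner_mx M q.
have TM : T *m M = l *: T.
  have : T *m (M - l%:M) = 0.
    have := Cayley_Hamilton M; rewrite Eq rmorphM /= rmorphB /= horner_mx_X horner_mx_C.
    by [].
  by rewrite mulmxBr mul_mx_scalar => /eqP; rewrite subr_eq0 => /eqP.
have MT : M *m T = l *: T.
  by rewrite -TM; have := comm_mx_horner q (comm_mx_refl M); rewrite /comm_mx => ->.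
have vT : v *m T = q.[l] *: v.
  have : root (q - q.[l]%:P) l by rewrite rootE !hornerE subrr.
  move=> /factor_theorem [h Eh].
  have -> : T = horner_mx M ('X - l%:P) *m horner_mx M h + (q.[l])%:M.
    rewrite -[_ *m _]/(_ * _) -rmorphM /= mulrC -Eh rmorphB /= horner_mx_C.
    by rewrite subrK.
  rewrite mulmxDr mulmxA rmorphB /= horner_mx_X horner_mx_C mulmxBr vM.
  by rewrite mul_mx_scalar subrr mul0mx add0r mul_mx_scalar.
have [c Hc] : exists c : 'I_n.+1 -> F, forall i, row i T = c i *: v.
  have H i : exists c, row i T = c *: v.
    apply: (eigenvector_unique m1 v0 vM).
    by rewrite -row_mul TM; apply/rowP => j; rewrite !mxE.
  by have [c Hc] := choice H; exists c.
pose phi0 : 'cV[F]_n.+1 := \col_i c i.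
have Tphi : T = phi0 *m v.
  apply/row_matrixP => i; rewrite Hc row_mul.
  by apply/rowP => j; rewrite !mxE big_ord1 !mxE.
have ql0 : q.[l] != 0 by rewrite -rootE.
have vphi0 : v *m phi0 = (q.[l])%:M.
  have := vT; rewrite Tphi mulmxA [v *m phi0]mx11_scalar mul_scalar_mx.
  move=> /eqP; rewrite -subr_eq0 -scalerBl scaler_eq0 (negPf v0) orbF subr_eq0.
  by move=> /eqP ->.
exists v, ((q.[l])^-1 *: phi0); split=> //.
- have E : M *m phi0 *m v = (l *: phi0) *m v by rewrite -mulmxA -Tphi MT -scalemxAl Tphi.
  rewrite -scalemxAr; rewrite scalerA mulrC -scalerA; congr (_ *: _).
  have [j vj] : exists j, v 0 j != 0.
    apply: contrapT => H; case/eqP: v0; apply/rowP => j; rewrite mxE.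
    by apply/eqP; apply: contrapT => /negP h; apply: H; exists j.
  apply/colP => i; apply: (mulIf vj).
  by have /matrixP /(_ i j) := E; rewrite !mxE !big_ord1 !mxE.
- by rewrite -scalemxAr vphi0 scale_scalar_mx mulVf.
Qed.

End SimpleEigenvalue.

(** * The leading eigenvalue of a real operator *)

Section LeadingEigenvalue.
Variable R : realType.
Local Notation RC := (real_complex R).

Lemma mup_map (F K : fieldType) (f : {rmorphism F -> K}) (p : {poly F}) x :
  p != 0 -> mup (f x) (map_poly f p) = mup x p.
Proof.
move=> p0; have fp0 : map_poly f p != 0 by rewrite map_poly_eq0.
have E n : (n <= mup (f x) (map_poly f p))%N = (n <= mup x p)%N.
  rewrite !mup_geq // -(dvdp_map f) rmorphXn rmorphB /= map_polyX map_polyC //.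
by apply/eqP; rewrite eqn_leq -E leqnn E leqnn.
Qed.

Lemma eigen_roots n (M : 'M[R[i]]_n) : exists rs : seq R[i],
  forall z, eigenvalue M z = (z \in rs).
Proof.
have [rs Ers] := closed_field_poly_normal (char_poly M).
exists rs => z; rewrite eigenvalue_root_char Ers.
by rewrite (monicP (char_poly_monic M)) scale1r root_prod_XsubC.
Qed.

Lemma has_sup_eigen (V : vectType R) (f : 'End(V)) l : complex_eigenvalue f l ->
  has_sup [set Normc.normc l | l in [set l | complex_eigenvalue f l]].
Proof.
move=> fl; split; first by exists (Normc.normc l), l.
have [rs Hrs] := eigen_roots (complex_mx f).
exists (\sum_(z <- rs) Normc.normc z) => _ [z /= fz <-].
have zrs : z \in rs by rewrite -Hrs.
rewrite (big_rem z zrs) /= lerDl; apply: sumr_ge0 => *; exact: normc_ge0.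
Qed.

Lemma eigen_le_spectral_radius (V : vectType R) (f : 'End(V)) l :
  complex_eigenvalue f l -> Normc.normc l <= spectral_radius f.
Proof. by move=> fl; apply: (ub_le_sup (has_sup_eigen fl).2); exists l. Qed.

(** The leading eigenvalue is real, since its conjugate is also an eigenvalue of the
    same modulus. An eigenvector of M - sg phi v for a nonzero eigenvalue is
    annihilated by phi, so it is an eigenvector of M; it is not proportional to v,
    so that its eigenvalue is not the leading one. *)
Lemma leading_data (V : vectType R) (f : 'End(V)) :
  let M := mxof (vbasis {: V}) (vbasis {: V}) f in
  unique_simple_leading_eigenvalue f -> 0 < spectral_radius f ->
  exists (sg q0 : R) (v : 'rV_(\dim {: V})) (phi : 'cV_(\dim {: V})),
    [/\ `|sg| = spectral_radius f, 0 <= q0 < spectral_radius f &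
    [/\ v *m M = sg *: v, M *m phi = sg *: phi, v *m phi = 1%:M,
        spec_le (M - sg *: (phi *m v)) q0 & spec_le M (spectral_radius f)]].
Proof.
move=> M [l [fl lead m1]] rho0.
have Mrho : spec_le M (spectral_radius f) by move=> z; exact: eigen_le_spectral_radius.
set rho := spectral_radius f in rho0 Mrho *.
have lrho : Normc.normc l = rho.
  apply/eqP; rewrite eq_le eigen_le_spectral_radius //=.
  apply: ge_sup; first exact: (has_sup_eigen fl).1.
  move=> _ [z /= fz <-]; have [->//|zl] := eqVneq z l.
  by apply/ltW/lead => //; exact/eqP.
have [sg Esg] : exists sg, l = RC sg.
  have fl' : complex_eigenvalue f (conjc l).
    move: fl; rewrite /complex_eigenvalue => /eigenvalueP [x xM x0].
    apply/eigenvalueP; exists (map_mx conjc x); last by rewrite map_mx_eq0.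
    have := congr1 (map_mx conjc) xM; rewrite map_mxM map_mxZ => <-.
    congr (_ *m _); apply/matrixP => i j; rewrite !mxE.
    by rewrite [RHS]/= oppr0.
  have cl : conjc l = l.
    apply: contrapT => /(lead _ fl'); case: (l) => a b /=.
    by rewrite sqrrN ltxx.
  move: cl; case: (l) => a b /= [h]; exists a.
  by have -> : b = 0 by move: h; lra.
have nsg : `|sg| = rho by rewrite -lrho Esg normc_real.
have m1' : mup sg (char_poly M) = 1%N.
  rewrite -m1 /alg_multiplicity Esg /complex_mx -map_char_poly mup_map //.
  by rewrite monic_neq0 // char_poly_monic.
have esg : eigenvalue M sg.
  by move: fl; rewrite /complex_eigenvalue Esg /complex_mx eigenvalue_map.
have [v [phi [vM Mphi vphi]]] := simple_eigen esg m1'.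
have [rs Hrs] := eigen_roots (complex_mx f).
pose q0 : R := \big[Num.max/0]_(z <- rs | z != l) Normc.normc z.
have q0b : 0 <= q0 < rho.
  apply/andP; split; first exact: bigmax_ge_id.
  rewrite /q0 big_seq_cond; apply: bigmax_lt; first exact: rho0.
  move=> z /andP [zrs zl]; rewrite -lrho.
  by apply: lead; [rewrite /complex_eigenvalue Hrs|exact/eqP].
suff specS : spec_le (M - sg *: (phi *m v)) q0.
  by exists sg, q0, v, phi; split; [exact: nsg|exact: q0b|split].
move=> z /eigenvalueP [y yS y0].
have [->|z0] := eqVneq z 0; first by rewrite Normc.normc0; exact: bigmax_ge_id.
set vC := map_mx RC v; set pC := map_mx RC phi.
have E : y *m complex_mx f - (RC sg * (y *m pC) 0 0) *: vC = z *: y.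
  rewrite -yS map_mxB map_mxZ map_mxM mulmxBr; congr (_ - _).
  rewrite -scalemxAr mulmxA -scalerA; congr (_ *: _).
  by rewrite {2}[y *m pC]mx11_scalar mul_scalar_mx.
have vpC : vC *m pC = 1%:M by rewrite -map_mxM vphi map_mx1.
have yp : (y *m pC) 0 0 = 0.
  have := congr1 (fun m => (m *m pC) 0 0) E.
  rewrite mulmxBl -mulmxA (_ : complex_mx f *m pC = RC sg *: pC); last first.
    by rewrite -map_mxM Mphi map_mxZ.
  rewrite -scalemxAr -!scalemxAl vpC !mxE mulr1 subrr => /esym /eqP.
  rewrite mulf_eq0 (negPf z0) /= => /eqP H; rewrite ?mxE.
  exact: H.
rewrite yp mulr0 scale0r subr0 in E.
have fz : complex_eigenvalue f z by apply/eigenvalueP; exists y.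
have [zl|zl] := eqVneq z l.
  case/eqP: y0.
  have vC0 : vC != 0.
    rewrite map_mx_eq0; apply/eqP => v0; move: vphi; rewrite v0 mul0mx.
    by move=> /matrixP /(_ 0 0); rewrite !mxE eqxx => /eqP; rewrite eq_sym oner_eq0.
  have vCM : vC *m complex_mx f = l *: vC by rewrite -map_mxM vM map_mxZ Esg.
  rewrite zl in E.
  have [c Ec] := eigenvector_unique m1 vC0 vCM E.
  by move: yp; rewrite Ec -scalemxAl vpC !mxE eqxx mulr1 => ->; rewrite scale0r.
apply: (@le_bigmax_seq _ _ _ _ _ z); rewrite -?Hrs //.
Qed.

End LeadingEigenvalue.

(** * The direct sum of the spaces of a triplet *)

Section TotalSpace.
Variables (R : realType) (G : multigraph) (xi : triplet R G).
Local Notation n := (nvert G).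
Local Notation RC := (real_complex R).
Local Notation d i := (\dim {: lspace xi i}).
Local Notation b i := (vbasis {: lspace xi i}).

Definition coords := {i : 'I_n & 'I_(d i)}.
Local Notation D := #|{: coords}|.

(** In coordinates, the inclusion of the i-th summand in the direct sum; its
    transpose is the projection on this summand. *)
Definition incl i : 'M[R]_(d i, D) :=
  \matrix_(k, t) (enum_val t == Tagged (fun i => 'I_(d i)) k)%:R.
Definition proj i : 'M[R]_(D, d i) := (incl i)^T.

Lemma sum_delta (T : finType) (x y : T) :
  \sum_(t : T) (t == x)%:R * (t == y)%:R = (x == y)%:R :> R.
Proof.
rewrite (bigD1 x) //= eqxx mul1r big1 ?addr0 // => t /negPf tx.
by rewrite tx mul0r.
Qed.

Lemma incl_projE i j k l : (incl i *m proj j) k l =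
  (Tagged (fun i => 'I_(d i)) k == Tagged (fun i => 'I_(d i)) l)%:R.
Proof.
rewrite mxE -sum_delta (reindex (@enum_val coords predT)) /=; last first.
  by apply: onW_bij; exact: enum_val_bij.
by apply: eq_bigr => t _; rewrite !mxE.
Qed.

Lemma incl_proj i : incl i *m proj i = 1%:M.
Proof.
by apply/matrixP => k l; rewrite incl_projE mxE -tag_eqE /tag_eq /= eqxx tagged_asE.
Qed.

Lemma incl_proj0 i j : i != j -> incl i *m proj j = 0.
Proof.
move=> ij; apply/matrixP => k l; rewrite incl_projE mxE -tag_eqE /tag_eq /=.
by rewrite (negPf ij).
Qed.

Lemma sum_proj_incl : \sum_i proj i *m incl i = 1%:M.
Proof.
apply/matrixP => s t; rewrite summxE mxE.
under eq_bigr do rewrite mxE.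
rewrite (sig_big_dep xpredT (fun _ => xpredT)
  (fun i k => (proj i) s k * (incl i) k t)) /=.
rewrite -(inj_eq enum_val_inj) -sum_delta.
apply: eq_bigr => -[i k] _; rewrite !mxE /= eq_sym; congr (_ * _).
by rewrite eq_sym.
Qed.

Definition edgeT : finType := {ij : 'I_n * 'I_n & edge ij.1 ij.2}.

(** The operator of an edge, extended by zero to the direct sum. Products along
    words that are not walks vanish. *)
Definition emx (e : edgeT) : 'M[R]_D :=
  proj (tag e).1 *m mxof (b (tag e).1) (b (tag e).2) (op xi (tagged e)) *m incl (tag e).2.

Definition word i j (w : walk i j) : seq edgeT := edges w.

Lemma incl_wmx i j (w : walk i j) :
  incl i *m wmx emx (word w) = mxof (b i) (b j) (wprod xi w) *m incl j.
Proof.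
rewrite /word; elim: w => [|j' k w IH e] /=.
  by rewrite wmx_nil mulmx1 mxof1 ?mul1mx // (basis_free (vbasisP _)).
rewrite wmx_rcons mulmxA IH /emx /= !mulmxA -[_ *m incl j' *m _]mulmxA incl_proj mulmx1.
by rewrite (mxof_comp (b i) (b k) (vbasisP {: lspace xi j'})).
Qed.

Lemma wmx_walk i j (w : walk i j) : (0 < walk_length w)%N ->
  wmx emx (word w) = proj i *m mxof (b i) (b j) (wprod xi w) *m incl j.
Proof.
rewrite /word /walk_length; elim: w => // j' k w IH e _ /=.
rewrite wmx_rcons; case: w IH e => [|j1 k1 w e1] IH e.
  by rewrite /= wmx_nil mul1mx /emx /= comp_lfun1r.
rewrite IH; last by rewrite /= size_rcons.
rewrite /emx [tag _]/= [tagged _]/= !mulmxA -[_ *m incl k1 *m _]mulmxA incl_proj mulmx1.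
by rewrite (mxof_comp (b i) (b k) (vbasisP {: lspace xi k1})) !mulmxA.
Qed.

Lemma word_cases (s : seq edgeT) : s != [::] ->
  wmx emx s = 0 \/ exists i j (w : walk i j), word w = s.
Proof.
elim/last_ind: s => // s [[j' k] e] IH _.
have [->|s0] := eqVneq s [::].
  by right; exists j', k, (walk_rcons (walk_nil j') e).
have [sz|[i [j [w ws]]]] := IH s0; first by left; rewrite wmx_rcons sz mul0mx.
have [jj'|jj'] := eqVneq j j'.
  by subst j'; right; exists i, k, (walk_rcons w e); rewrite /word /= -ws.
left; rewrite wmx_rcons -ws wmx_walk; last first.
  by rewrite /walk_length -/(word w) ws lt0n size_eq0.
rewrite /emx /= !mulmxA -[_ *m incl j *m _]mulmxA incl_proj0 //.
by rewrite mulmx0 !mul0mx.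
Qed.

(** y is the component of an eigenvector in the i-th summand. For distinct i and j
    the conclusion is contradictory, since incl j *m proj i is then zero. *)
Lemma compress_eigen i j (M : 'M[R]_(d i, d j)) l : l != 0 ->
  eigenvalue (map_mx RC (proj i *m M *m incl j)) l ->
  exists2 y : 'rV[R[i]]_(d i), y != 0 & y *m map_mx RC (M *m (incl j *m proj i)) = l *: y.
Proof.
move=> l0 /eigenvalueP [x Ex x0]; exists (x *m map_mx RC (proj i)).
  apply: contra x0 => /eqP y0; move: Ex; rewrite !map_mxM !mulmxA y0 !mul0mx.
  by move=> /esym /eqP; rewrite scaler_eq0 (negPf l0).
have := congr1 (mulmx^~ (map_mx RC (proj i))) Ex; rewrite /= -scalemxAl => <-.
by rewrite !map_mxM !mulmxA.
Qed.

Lemma spec_compress i (M : 'M[R]_(d i)) r : 0 <= r -> spec_le M r ->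
  spec_le (proj i *m M *m incl i) r.
Proof.
move=> r0 Mr l; have [->|l0] := eqVneq l 0; first by rewrite Normc.normc0.
move=> /(compress_eigen l0) [y y0]; rewrite incl_proj mulmx1 => Ey.
by apply: Mr; apply/eigenvalueP; exists y.
Qed.

(** Words other than closed walks have nilpotent products. *)
Lemma spec_word (s : seq edgeT) r : 0 <= r -> s != [::] ->
  (forall i (w : walk i i), word w = s ->
     spec_le (mxof (b i) (b i) (wprod xi w)) r) ->
  spec_le (wmx emx s) r.
Proof.
move=> r0 s0 H l; have [->|l0] := eqVneq l 0; first by rewrite Normc.normc0.
have [->|[i [j [w ws]]]] := word_cases s0.
  move=> /eigenvalueP [x]; rewrite map_mx0 mulmx0 => /esym /eqP.
  by rewrite scaler_eq0 (negPf l0) /= => /eqP -> /eqP.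
rewrite -ws wmx_walk; last by rewrite /walk_length -/(word w) ws lt0n size_eq0.
have [ij|ij] := eqVneq i j; first by subst j; apply: spec_compress => //; exact: H.
move=> /(compress_eigen l0) [y y0]; rewrite incl_proj0 1?eq_sym // mulmx0 map_mx0.
by rewrite mulmx0 => /esym /eqP; rewrite scaler_eq0 (negPf l0) (negPf y0).
Qed.

Lemma wprod_power i (w c : walk i i) m : edges w = flatten (nseq m (edges c)) ->
  mxof (b i) (b i) (wprod xi w) = mxof (b i) (b i) (wprod xi c) ^+ m.
Proof.
move=> E; rewrite -[LHS]mulmx1 -(incl_proj i) mulmxA -incl_wmx.
rewrite (_ : word w = flatten (nseq m (word c))) // wmx_flatten_nseq {E}.
have -> : incl i *m wmx emx (word c) ^+ m = mxof (b i) (b i) (wprod xi c) ^+ m *m incl i.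
  elim: m => [|m IH]; first by rewrite !expr0 mulmx1 mul1mx.
  by rewrite exprS mulmxA incl_wmx -mulmxA IH mulmxA exprS.
by rewrite -mulmxA incl_proj mulmx1.
Qed.

Lemma primitive_root (i : 'I_n) (w : walk i i) : (0 < walk_length w)%N ->
  exists (c : walk i i) (m : nat),
    simple_closed c /\ edges w = flatten (nseq m (edges c)).
Proof.
have [k] := ubnP (walk_length w); elim: k w => // k IH w; rewrite ltnS => wk w0.
have [sw|nsw] := pselect (simple_closed w).
  by exists w, 1%N; split=> //=; rewrite cats0.
have [c [m [cw Ew]]] : exists (c : walk i i) (m : nat),
    (walk_length c < walk_length w)%N /\ edges w = flatten (nseq m (edges c)).
  by apply: contrapT => H; apply: nsw; split.
have c0 : (0 < walk_length c)%N.
  rewrite lt0n; apply/eqP => c0; move: w0; rewrite /walk_length Ew.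
  have -> : edges c = [::] by apply/eqP; rewrite -size_eq0; exact/eqP.
  by case: (m) => // m'; elim: m' => //= m' ->.
have [r [m' [sr Ec]]] := IH c (leq_trans cw wk) c0.
exists r, (m * m')%N; split=> //.
rewrite Ew Ec; elim: (m) => // m'' IHm.
by rewrite mulSn nseqD flatten_cat /= IHm.
Qed.

(** Take a subspace of maximal dimension among those contained in P. *)
Lemma vspace_of_prop (K : fieldType) (V : vectType K) (P : V -> Prop) : P 0 ->
  (forall c x y, P x -> P y -> P (c *: x + y)) ->
  exists U : {vspace V}, forall x, x \in U <-> P x.
Proof.
move=> P0 PL.
pose good k := `[< exists2 U : {vspace V}, (forall x, x \in U -> P x) & \dim U = k >].
have g0 : exists k, good k.
  exists 0%N; apply/asboolP; exists 0%VS; rewrite ?dimv0 // => x.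
  by rewrite memv0 => /eqP ->.
have gb k : good k -> (k <= \dim {: V})%N.
  by move=> /asboolP [U _ <-]; exact/dimvS/subvf.
case: (ex_maxnP g0 gb) => k /asboolP [U UP Uk] kmax.
exists U => x; split; first exact: UP.
move=> Px.
have : good (\dim (<[x]> + U)).
  apply/asboolP; exists (<[x]> + U)%VS => // y /memv_addP [u /vlineP [c ->] [u' u'U ->]].
  by apply: PL => //; apply: UP.
move=> /kmax; rewrite -Uk => le.
have := dimv_leqif_sup (addvSr <[x]> U) => H.
have : (<[x]> + U <= U)%VS by rewrite -H eqn_leq le dimvS // addvSr.
by move=> /subvP; apply; exact: (subvP (addvSl _ _) _ (memv_line x)).
Qed.

Definition emb i (x : lspace xi i) : 'rV[R]_D := rVof (b i) x *m incl i.

Lemma emb_lin i c (x y : lspace xi i) : emb (c *: x + y) = c *: emb x + emb y.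
Proof. by rewrite /emb linearP mulmxDl scalemxAl. Qed.

Lemma emb_inj0 i (x : lspace xi i) : emb x = 0 -> x = 0.
Proof.
move=> /(congr1 (mulmx^~ (proj i))); rewrite /emb -mulmxA incl_proj mulmx1 mul0mx.
by move=> /eqP; rewrite rVof_eq0 ?vbasisP // => /eqP.
Qed.

Lemma emb_edge i j (e : edge i j) (x : lspace xi i) :
  emb x *m emx (pack e) = emb (op xi e x).
Proof.
rewrite /emb /emx /= !mulmxA -[_ *m incl i *m _]mulmxA incl_proj mulmx1.
by rewrite (rVof_app (b j) (vbasisP {: lspace xi i})).
Qed.

Lemma emb_other i (e : edgeT) (x : lspace xi i) : i != (tag e).1 -> emb x *m emx e = 0.
Proof.
move=> ie; rewrite /emb /emx !mulmxA -[_ *m incl i *m _]mulmxA incl_proj0 //.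
by rewrite mulmx0 !mul0mx.
Qed.

(** An invariant predicate on the direct sum induces embedded subspaces of the
    summands. It contains the components of its elements, because the images of the
    component x_i under the edges are images of x or zero. *)
Lemma irreducible_emx : irreducible xi -> irreducible_family emx.
Proof.
move=> irr P P0 PL PA.
have [U HU] : exists U : forall i, {vspace lspace xi i},
    forall i x, x \in U i <-> P (emb x).
  have H i : exists U : {vspace lspace xi i}, forall x, x \in U <-> P (emb x).
    apply: (@vspace_of_prop _ _ (fun x => P (emb x))).
      by rewrite /emb linear0 mul0mx.
    by move=> c x y; rewrite emb_lin; apply: PL.
  by exists (fun i => sval (cid (H i))) => i; exact: svalP (cid (H i)).
have embP i (y : 'rV[R]_(d i)) : y *m incl i = emb (vecof (b i) y).
  by rewrite /emb vecofK ?vbasisP.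
have decomp x : x = \sum_i emb (vecof (b i) (x *m proj i)).
  rewrite -[LHS]mulmx1 -sum_proj_incl mulmx_sumr; apply: eq_bigr => i _.
  by rewrite -embP mulmxA.
have Uinv i j (e : edge i j) : (op xi e @: U i <= U j)%VS.
  apply/subvP => _ /memv_imgP [x /HU Px ->]; apply/HU.
  by rewrite -emb_edge; move/PA: Px.
have [[i Ui]|U0] := pselect (exists i, U i != 0%VS).
  right=> x; rewrite (decomp x).
  have Ufull j : U j = fullv.
    apply/eqP; apply: contrapT => /negP Uj; apply: irr; exists U; split.
      by split; [exists i|exact: Uinv].
    by exists j.
  elim/big_rec : _ => // j y _ Py; rewrite -[emb _]scale1r; apply: PL => //.
  by apply/HU; rewrite Ufull memvf.
left=> x Px; rewrite (decomp x) big1 // => i _.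
have : P (emb (vecof (b i) (x *m proj i))).
  apply/PA => e; rewrite -embP; have [ie|ie] := eqVneq i (tag e).1; last first.
    by rewrite embP emb_other.
  have -> : x *m proj i *m incl i *m emx e = x *m emx e.
    case: e ie => -[j' k] e /= ie; subst j'.
    by rewrite /emx /= !mulmxA -[_ *m incl i *m _]mulmxA incl_proj mulmx1.
  by move: e {ie}; apply/PA.
move=> /HU; have -> : U i = 0%VS.
  by apply/eqP; apply: contrapT => /negP Ui; apply: U0; exists i.
by rewrite memv0 => /eqP ->; rewrite /emb linear0 mul0mx.
Qed.

End TotalSpace.

(** * Construction of the multinorm *)

Section Assembly.
Variables (R : realType) (G : multigraph) (xi : triplet R G).
Local Notation n := (nvert G).
Local Notation b i := (vbasis {: lspace xi i}).
Local Notation mx w := (mxof (b _) (b _) (wprod xi w)).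

Hypothesis irr : irreducible xi.
Variables (i0 : 'I_n) (a : walk i0 i0) (sg q0 q : R).
Variables (v : 'rV[R]_(\dim {: lspace xi i0})) (phi : 'cV[R]_(\dim {: lspace xi i0})).
Hypothesis a0 : (0 < walk_length a)%N.
Hypothesis sg1 : `|sg| = 1.
Hypothesis q0b : 0 <= q0 < 1.
Hypothesis vM : v *m mx a = sg *: v.
Hypothesis Mphi : mx a *m phi = sg *: phi.
Hypothesis vphi : v *m phi = 1%:M.
Hypothesis specS : spec_le (mx a - sg *: (phi *m v)) q0.
Hypothesis speca : spec_le (mx a) 1.
Hypothesis q1 : q < 1.
Hypothesis dom : forall j (c : walk j j), simple_closed c -> ~ cyclic_perm a c ->
  spectral_radius (wprod xi c) < q.

(** The eigenvectors of the dominant product, in the direct sum. *)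
Let vt := v *m incl xi i0.
Let phit := proj xi i0 *m phi.
Local Notation g := (pairing (emx xi) phit).

(** The last clause is the Barabanov identity at the empty walk, which may be
    replaced by a since phit is an eigenvector. *)
Lemma barabanov_functionals : exists W : seq (seq (edgeT G)),
  (forall x s, exists2 w, w \in W & `|g s x| <= `|g w x|) /\
  (forall x, (forall s, g s x = 0) -> x = 0) /\
  (forall x, exists e, exists s, `|g [::] x| = `|g s (x *m emx xi e)|).
Proof.
have [q0_ge0 q0_lt1] := andP q0b.
pose q' := Num.max q 0.
have q'0 : 0 <= q' by rewrite le_max lexx orbT.
have q'1 : q' < 1 by rewrite gt_max q1 ltr01.
have Ea := wmx_walk xi a0.
have wa0 : word a != [::] by rewrite -size_eq0 -lt0n.
have va : vt *m wmx (emx xi) (word a) = sg *: vt.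
  by rewrite Ea /vt !mulmxA -(mulmxA v) incl_proj mulmx1 vM scalemxAl.
have aphi : wmx (emx xi) (word a) *m phit = sg *: phit.
  rewrite Ea /phit !mulmxA -[_ *m incl xi i0 *m _]mulmxA incl_proj mulmx1.
  by rewrite -mulmxA Mphi scalemxAr.
have vphit : vt *m phit = 1%:M.
  by rewrite /vt /phit mulmxA -(mulmxA v) incl_proj mulmx1.
have specSt : spec_le (wmx (emx xi) (word a) - sg *: (phit *m vt)) q0.
  have -> : wmx (emx xi) (word a) - sg *: (phit *m vt) =
      proj xi i0 *m (mx a - sg *: (phi *m v)) *m incl xi i0.
    rewrite Ea /phit /vt mulmxBr mulmxBl; congr (_ - _).
    by rewrite -scalemxAr -scalemxAl !mulmxA.
  exact: spec_compress.
have specat : spec_le (wmx (emx xi) (word a)) 1.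
  by rewrite Ea; exact: spec_compress.
have other s : s != [::] -> (forall k m, s <> flatten (nseq m (rot k (word a)))) ->
    spec_le (wmx (emx xi) s) q'.
  move=> s0 Hs; apply: spec_word => // i w ws.
  have w0 : (0 < walk_length w)%N by rewrite /walk_length -/(word w) ws lt0n size_eq0.
  have [c [m [sc Ew]]] := primitive_root w0.
  have m0 : (0 < m)%N.
    by rewrite lt0n; apply/eqP => m0; move: w0; rewrite /walk_length Ew m0.
  have nc : ~ cyclic_perm a c.
    move=> [k Ec]; apply: (Hs k m).
    by rewrite -ws /word Ew Ec.
  have cq : spec_le (mx c) q'.
    move=> l lc; rewrite (le_trans (eigen_le_spectral_radius lc)) //.
    by rewrite le_max (ltW (dom sc nc)).
  rewrite (wprod_power xi Ew) => l /(spec_leX m0 q'0 cq) H.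
  by rewrite (le_trans H) // -[leRHS]expr1 ler_wiXn2l // ltW.
have irrA := irreducible_emx irr.
have [W HW] := finite_maximum irrA wa0 sg1 va aphi vphit q0_ge0 q0_lt1 q'0 q'1
  specSt specat other.
exists W; split; first exact: HW.
split; first by move=> x; exact: (pairing_separates irrA wa0 sg1 aphi vphit).
move=> x; move: wa0 aphi; case: (word a) => // e s _ aphi; exists e, s.
have : sg * g [::] x = g (e :: s) x.
  by rewrite /pairing -[in RHS]mulmxA aphi -scalemxAr [RHS]mxE wmx_nil mulmx1.
move=> /(congr1 Num.norm); rewrite normrM sg1 mul1r => ->.
by rewrite /pairing wmx_cons !mulmxA.
Qed.

(** The norm of x is the largest value at x of the functionals carried back along
    walks. Carrying one of them back along one more edge stays in the family, and
    every member is obtained in this way up to sign, which is the Barabanov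
    identity. *)
Lemma normalized_barabanov : exists nu : forall i, lspace xi i -> R,
  polytope_multinorm xi nu /\ forall i (x : lspace xi i),
    \big[Num.max/0]_(j < n) \big[Num.max/0]_(e : edge i j) nu j (op xi e x) = nu i x.
Proof.
have [W [Wmax [Wsep Wnil]]] := barabanov_functionals.
pose NU y := \big[Num.max/0]_(w <- W) `|g w y|.
have NU_ge s y : `|g s y| <= NU y.
  have [w wW H] := Wmax y s; rewrite (le_trans H) //.
  exact: (@le_bigmax_seq _ _ _ _ _ w).
have NU_eq y : exists s, NU y = `|g s y|.
  have [w wW _] := Wmax y [::].
  have [s sW Hs] := max_seq (fun w => `|g w y|) wW.
  exists s; apply/eqP; rewrite eq_le NU_ge andbT /NU.
  by rewrite big_seq; apply: bigmax_le.
have gZ s c y : g s (c *: y) = c * g s y by rewrite /pairing -!scalemxAl mxE.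
have gD s y z : g s (y + z) = g s y + g s z by rewrite /pairing !mulmxDl mxE.
have NU0 y : 0 <= NU y by exact: bigmax_ge_id.
have NUZ c y : NU (c *: y) = `|c| * NU y.
  apply/eqP; rewrite eq_le; apply/andP; split.
    by have [s ->] := NU_eq (c *: y); rewrite gZ normrM ler_wpM2l.
  by have [s ->] := NU_eq y; rewrite -normrM -gZ.
have NUD y z : NU (y + z) <= NU y + NU z.
  have [s ->] := NU_eq (y + z); rewrite gD (le_trans (ler_normD _ _)) //.
  by rewrite lerD.
have NUsep y : NU y = 0 -> y = 0.
  move=> y0; apply: Wsep => s; apply/eqP; rewrite -normr_le0 -y0; exact: NU_ge.
have NUe y : exists e, NU y <= NU (y *m emx xi e).
  have [[|e s] ->] := NU_eq y; last first.
    by exists e; rewrite /pairing wmx_cons mulmxA; exact: NU_ge.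
  by have [e [s ->]] := Wnil y; exists e.
have NUe_le y e : NU (y *m emx xi e) <= NU y.
  have [s ->] := NU_eq (y *m emx xi e).
  by have := NU_ge (e :: s) y; rewrite /pairing wmx_cons mulmxA.
pose nu i (x : lspace xi i) := NU (emb x).
have nuN i : is_norm (@nu i).
  split=> [x|x /NUsep /emb_inj0 //|c x|x y]; rewrite /nu.
  - exact: NU0.
  - by rewrite -[c *: x]addr0 emb_lin /emb linear0 mul0mx addr0 NUZ.
  - by rewrite -{1}[x]scale1r emb_lin scale1r NUD.
exists nu; split; first split=> // i.
  (* indices 2k and 2k+1 stand for the k-th functional and its opposite *)
  pose f k (x : lspace xi i) := (-1) ^+ odd k * g (nth [::] W k./2) (emb x).
  have fl k : lin_form (f k).
    split=> [c x|x y]; rewrite /f.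
      by rewrite -[c *: x]addr0 emb_lin /emb linear0 mul0mx addr0 gZ mulrCA.
    by rewrite -{1}[x]scale1r emb_lin scale1r gD mulrDr.
  have nuf x : nu i x <= 1 <-> forall k, (k < (size W).*2)%N -> f k x <= 1.
    split=> [x1 k _|H].
      rewrite (le_trans (ler_norm _)) // /f normrM normrX normrN1 expr1n mul1r.
      by rewrite (le_trans (NU_ge _ _)).
    rewrite /nu /NU big_seq; apply: bigmax_le => // w /(nthP [::]) [k kW <-].
    rewrite ler_norml; apply/andP; split.
      have := H k.*2.+1; rewrite ltn_Sdouble /f /= odd_double /= uphalf_double => /(_ kW).
      by rewrite expr1 mulN1r lerNl.
    by have := H k.*2; rewrite ltn_double /f odd_double doubleK expr0 mul1r => /(_ kW).
  have -> : [set x | nu i x <= 1] = [set x | forall k, (k < (size W).*2)%N -> f k x <= 1].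
    by apply/seteqP; split=> x /= /nuf.
  have rVN : is_norm (fun x => nm (rVof (b i) x)).
    split=> [x|x /nm0_eq0 /eqP|c x|x y]; rewrite ?nm_ge0 ?linearZ ?linearD ?nmZ ?nmD //.
    by rewrite rVof_eq0 ?vbasisP // => /eqP.
  have [C C0 HC] := norm_equiv rVN (nuN i).
  apply: (@polytope_of_bounded _ _ _ _ C) => // x /nuf x1.
  have := HC x; rewrite /nm big_ord1; under eq_bigr do rewrite mxE.
  by move=> h; rewrite (le_trans h) // ler_piMr // ltW.
move=> i x; apply/eqP; rewrite eq_le; apply/andP; split.
  apply: bigmax_le; first exact: NU0.
  move=> j _; apply: bigmax_le; first exact: NU0.
  by move=> e _; rewrite /nu -emb_edge.
have [e He] := NUe (emb x); rewrite {1}/nu (le_trans He) //.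
have [ie|ie] := eqVneq i (tag e).1; last first.
  have -> : NU (emb x *m emx xi e) = 0.
    by rewrite emb_other // -(scale0r 0) NUZ normr0 mul0r.
  exact: bigmax_ge_id.
case: e ie He => -[i' j] e /= ie; subst i' => _.
rewrite -[existT _ _ _]/(pack e) emb_edge.
apply: le_trans (le_bigmax _ _ j); apply: (le_trans _ (le_bigmax _ _ e)).
by [].
Qed.

End Assembly.

Lemma wprod_scale (R : realType) (G : multigraph) (xi : triplet R G) (c : R)
    (i j : 'I_(nvert G)) (w : walk i j) :
  wprod (scale_triplet c xi) w = c ^+ walk_length w *: wprod xi w.
Proof.
rewrite /walk_length; elim: w => [|j' k w IH e] /=; first by rewrite expr0 scale1r.
rewrite IH size_rcons; apply/lfunP => x.
by rewrite scale_lfunE !comp_lfunE !scale_lfunE linearZ scalerA exprS.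
Qed.

Lemma irreducible_scale (R : realType) (G : multigraph) (xi : triplet R G) (c : R) :
  c != 0 -> irreducible xi -> irreducible (scale_triplet c xi).
Proof.
move=> c0 irr [U [[Un0 Uinv] Uf]]; apply: irr; exists U; split=> //; split=> //.
move=> i j e; apply/subvP => _ /memv_imgP [x xU ->].
rewrite -[op xi e x]scale1r -(mulVf c0) -scalerA memvZ //.
apply: (subvP (Uinv i j e)).
have -> : c *: op xi e x = op (scale_triplet c xi) e x by rewrite /= scale_lfunE.
exact: memv_img.
Qed.

Theorem corollary3 (R : realType) (G : multigraph) (xi : triplet R G) :
  strongly_connected G ->
  irreducible xi ->
  (exists (i : 'I_(nvert G)) (a : walk i i),
     dominant xi a /\ unique_simple_leading_eigenvalue (wprod xi a)) ->
  exists nu : (forall i, lspace xi i -> R),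
    polytope_multinorm xi nu /\ barabanov xi nu.
Proof.
move=> _ irr [i [a [[[a0 _] rho0 [q q1 dom]] lead]]].
set rho := spectral_radius (wprod xi a) in rho0.
set k := walk_length a in a0.
pose c := rho `^ (- k%:R^-1).
have c0 : 0 < c by apply: powR_gt0.
have ck : c ^+ k = rho^-1.
  rewrite -powR_mulrn ?(ltW c0) // -powRrM mulNr mulVf ?pnatr_eq0 -?lt0n //.
  by rewrite powR_inv1 // ltW.
have irr' := irreducible_scale (lt0r_neq0 c0) irr.
have [sg [q0 [v [phi [sg1 /andP [q0_ge0 q0_lt] [vM Mphi vphi specS specM]]]]]] :=
  leading_data lead rho0.
rewrite -/rho in sg1 q0_lt specM.
have Emx : mxof (vbasis {: lspace xi i}) (vbasis {: lspace xi i})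
     (wprod (scale_triplet c xi) a) =
   rho^-1 *: mxof (vbasis {: lspace xi i}) (vbasis {: lspace xi i}) (wprod xi a).
  by rewrite wprod_scale -/k ck linearZ.
have rV0 : 0 < rho^-1 by rewrite invr_gt0.
have [||||||nu [nuP nuB]] := @normalized_barabanov R G (scale_triplet c xi) irr' i a
  (rho^-1 * sg) (rho^-1 * q0) q v phi a0 _ _ _ _ vphi _ _ q1 dom.
- by rewrite normrM sg1 gtr0_norm // mulVf // gt_eqF.
- by rewrite mulr_ge0 ?(ltW rV0) //= mulrC ltr_pdivrMr // mul1r.
- by rewrite Emx -scalemxAr vM scalerA.
- by rewrite Emx -scalemxAl Mphi scalerA.
- have := spec_leZ rV0 specS; rewrite scalerBr scalerA -Emx; apply.
- have := spec_leZ rV0 specM; rewrite -Emx mulVf ?gt_eqF //; apply.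
have Elam x y : nu x (c *: y) = c * nu x y.
  by have [_ _ nuZ _] := nuP.1 x; rewrite nuZ gtr0_norm.
have nuB' j (x : lspace xi j) :
    \big[Num.max/0]_(l < nvert G) \big[Num.max/0]_(e : edge j l) nu l (op xi e x) =
    c^-1 * nu j x.
  have maxZ (I : finType) (F : I -> R) :
      \big[Num.max/0]_l (c * F l) = c * \big[Num.max/0]_l F l.
    apply/esym; apply: (big_morph (fun y => c * y)); last exact: mulr0.
    by move=> y z; rewrite maxr_pMr // ltW.
  rewrite -nuB -[LHS](mulKf (lt0r_neq0 c0)) -maxZ; congr (_ * _).
  apply: eq_bigr => l _; rewrite -maxZ; apply: eq_bigr => e _.
  by rewrite -Elam /= scale_lfunE.
exists nu; split; first exact: nuP.
have nuN : is_multinorm xi nu := nuP.1.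
have cV0 : 0 < c^-1 by rewrite invr_gt0.
have n0 : (0 < nvert G)%N by apply: leq_ltn_trans (ltn_ord i).
by move=> j x; rewrite (jsr_of_barabanov nuN cV0 nuB' n0); exact: nuB'.
Qed.
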